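(* Let $I\subseteq F\{U\}$ and $J\subseteq F\{V\}$ be characterizable differential ideals (in differential polynomial rings over the same differential field $F$ with the same derivations $\Delta$, $|\Delta|=n$), and suppose there is a differential birational map from $F\{U\}/I$ to $F\{V\}/J$. Then the differential dimension polynomials $\omega_I$ and $\omega_J$ have the same degree $d$, and, writing $\omega_I(\ell)=\sum_{i=0}^n a_i\binom{\ell+i}{i}$ and $\omega_J(\ell)=\sum_{i=0}^n b_i\binom{\ell+i}{i}$ with integer coefficients, $a_i=b_i$ for all $i\ge d$.
   Context: $F$ is a differential field of characteristic zero with $n$ pairwise commuting derivations $\Delta=\{\partial_1,\dots,\partial_n\}$; $F\{U\}$ (resp. $F\{V\}$) is the differential polynomial ring in finitely many differential indeterminates $U$ (resp. $V$), i.e. the polynomial ring in all derivatives $\partial^\mu u$ ($u\in U$, $\mu\in\mathbb{Z}_{\ge0}^n$); $F\{U\}_{\le\ell}$ is the subring of polynomials in derivatives of order $|\mu|\le\ell$, and $I_{\le\ell}:=I\cap F\{U\}_{\le\ell}$. Characterizable differential ideal: a differential ideal of the form $\mathcal{I}(S)=\langle S\rangle_\Delta:(\mathrm{ini}(S)\cup\mathrm{sep}(S))^\infty$ with $S$ a differential regular chain with respect to an orderly ranking (a finite weakly triangular coherent set such that for each leader $x$ the initial and separant of $S_x$ are not zero divisors modulo $\mathcal{I}(S_{<x})$). The differential dimension polynomial $\omega_I$ is the numerical polynomial that agrees with $\ell\mapsto\dim(F\{U\}_{\le\ell}/I_{\le\ell})$ (Krull dimension) for all large $\ell$. For a commutative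 ring $R$, $\mathrm{quot}(R)$ denotes its total quotient ring. A differential birational map from $R=F\{U\}/I$ to $R'=F\{V\}/J$ is an $F$-algebra isomorphism $\mathrm{quot}(R)\to\mathrm{quot}(R')$ commuting with the derivations. *)

(* Defs.v *)
From HB Require Import structures.
From mathcomp Require Import all_boot all_order all_algebra.
From mathcomp Require Import finmap.
From mathcomp Require Import monalg.

Set Implicit Arguments.
Unset Strict Implicit.
Unset Printing Implicit Defensive.

Import Order.TTheory GRing.Theory Num.Theory.
Local Open Scope ring_scope.

Section DiffAlg.

Variables (F : fieldType) (n : nat).

Definition is_diff_field (der : 'I_n -> F -> F) : Prop :=
  [/\ [pchar F] =i pred0,
      (forall i x y, der i (x + y) = der i x + der i y),
      (forall i x y, der i (x * y) = der i x * y + x * der i y) &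
      (forall i j x, der i (der j x) = der j (der i x))].

Variable der : 'I_n -> F -> F.

(* Derivatives  d^mu u  of the m differential indeterminates u : 'I_m *)
Definition dvar (m : nat) := ('I_m * {ffun 'I_n -> nat})%type.

Variable m : nat.

Definition ordv (x : dvar m) : nat := (\sum_(i < n) x.2 i)%N.

Definition shiftv (i : 'I_n) (x : dvar m) : dvar m :=
  (x.1, [ffun j => (x.2 j + (j == i))%N]).

Definition is_derivative_of (x y : dvar m) : Prop :=
  x.1 = y.1 /\ forall j, (y.2 j <= x.2 j)%N.

(* the differential polynomial ring F{U}, U of cardinality m *)
Definition DP := {malg F[{cmonom (dvar m)}]}.

Definition Xv (x : dvar m) : DP := << ucm x >>.

Definition dmon (i : 'I_n) (k : {cmonom (dvar m)}) : DP :=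
  \sum_(x <- finsupp k) ((k x)%:R * << divcm k (ucm x) >> * Xv (shiftv i x)).

Definition dder (i : 'I_n) (p : DP) : DP :=
  \sum_(k <- msupp p) (<< der i p@_k *g k >> + p@_k *: dmon i k).

Definition dop (mu : {ffun 'I_n -> nat}) (p : DP) : DP :=
  foldr (fun i q => iter (mu i) (dder i) q) p (enum 'I_n).

Definition is_ideal (I : DP -> Prop) : Prop :=
  [/\ I 0, (forall p q, I p -> I q -> I (p + q)) &
      (forall r p, I p -> I (r * p))].

Definition is_dideal (I : DP -> Prop) : Prop :=
  is_ideal I /\ forall i p, I p -> I (dder i p).

Definition ideal_gen (A : DP -> Prop) : DP -> Prop :=
  fun p => forall J, is_ideal J -> (forall a, A a -> J a) -> J p.

Definition dideal_gen (A : DP -> Prop) : DP -> Prop :=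
  fun p => forall J, is_dideal J -> (forall a, A a -> J a) -> J p.

Definition mclos (H : DP -> Prop) (h : DP) : Prop :=
  exists l : seq DP, (forall x, x \in l -> H x) /\ h = \prod_(x <- l) x.

Definition saturation (J H : DP -> Prop) : DP -> Prop :=
  fun p => exists h, mclos H h /\ J (h * p).

Definition is_orderly_ranking (rk : rel (dvar m)) : Prop :=
  [/\ irreflexive rk, transitive rk,
      (forall x y, x != y -> rk x y || rk y x) &
      [/\ (forall i x, rk x (shiftv i x)),
       (forall i x y, rk x y -> rk (shiftv i x) (shiftv i y)) &
       (forall x y, (ordv x < ordv y)%N -> rk x y)]].

Variable rk : rel (dvar m).

Definition occurs (p : DP) (x : dvar m) : Prop :=
  exists2 k, k \in msupp p & x \in finsupp k.

Definition leader (p : DP) (x : dvar m) : Prop :=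
  occurs p x /\ forall y, occurs p y -> y = x \/ rk y x.

Definition degx (p : DP) (x : dvar m) : nat := (\max_(k <- msupp p) k x)%N.

Definition initial (p : DP) (x : dvar m) : DP :=
  \sum_(k <- msupp p | k x == degx p x)
     << p@_k *g divcm k (expcmn (ucm x) (k x)) >>.

Definition separant (p : DP) (x : dvar m) : DP :=
  \sum_(k <- msupp p) << (k x)%:R * p@_k *g divcm k (ucm x) >>.

Definition HA (A : DP -> Prop) : DP -> Prop :=
  fun h => exists s x, [/\ A s, leader s x & (h = initial s x \/ h = separant s x)].

Definition IS (A : DP -> Prop) : DP -> Prop :=
  saturation (dideal_gen A) (HA A).

Definition weakly_triangular (S : seq DP) : Prop :=
  (forall s, s \in S -> exists x, leader s x) /\
  (forall a b ua ub, a \in S -> b \in S -> a != b ->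
     leader a ua -> leader b ub -> ~ is_derivative_of ua ub).

Definition lcmv (x y : dvar m) : {ffun 'I_n -> nat} :=
  [ffun j => maxn (x.2 j) (y.2 j)].

Definition subv (w : {ffun 'I_n -> nat}) (x : dvar m) : {ffun 'I_n -> nat} :=
  [ffun j => (w j - x.2 j)%N].

Definition coherent (S : seq DP) : Prop :=
  forall a b ua ub, a \in S -> b \in S -> leader a ua -> leader b ub ->
    ua.1 = ub.1 ->
    let w := lcmv ua ub in
    let Delta := separant b ub * dop (subv w ua) a
                 - separant a ua * dop (subv w ub) b in
    saturation
      (ideal_gen (fun q => exists c uc (th : {ffun 'I_n -> nat}),
          [/\ c \in S, leader c uc,
              rk (uc.1, [ffun j => (uc.2 j + th j)%N]) (ua.1, w)
            & q = dop th c]))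
      (HA (fun s => s \in S)) Delta.

Definition nzd_mod (I : DP -> Prop) (p : DP) : Prop :=
  forall q, I (p * q) -> I q.

Definition S_lt (S : seq DP) (x : dvar m) : DP -> Prop :=
  fun s => s \in S /\ exists y, leader s y /\ rk y x.

Definition diff_regular_chain (S : seq DP) : Prop :=
  [/\ weakly_triangular S, coherent S &
      forall s x, s \in S -> leader s x ->
        nzd_mod (IS (S_lt S x)) (initial s x) /\
        nzd_mod (IS (S_lt S x)) (separant s x)].

End DiffAlg.

Section Charac.
Variables (F : fieldType) (n : nat) (der : 'I_n -> F -> F) (m : nat).

Local Notation DP := (DP F n m).

Definition characterizable (I : DP -> Prop) : Prop :=
  exists (rk : rel (dvar n m)) (S : seq DP),
    [/\ is_orderly_ranking rk, diff_regular_chain der rk S &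
        forall p, I p <-> IS der rk (fun s => s \in S) p].

Definition ord_le (l : nat) (p : DP) : Prop :=
  forall k, k \in msupp p -> forall x, x \in finsupp k -> (ordv x <= l)%N.

(* Krull dimension of S/J, S a subring of F{U} and J an ideal of S:
   suprema of lengths of chains of prime ideals of S containing J *)
Definition is_subideal (S P : DP -> Prop) : Prop :=
  [/\ (forall p, P p -> S p), P 0, (forall p q, P p -> P q -> P (p + q)) &
      (forall r p, S r -> P p -> P (r * p))].

Definition is_subprime (S P : DP -> Prop) : Prop :=
  [/\ is_subideal S P, ~ P 1 &
      forall a b, S a -> S b -> P (a * b) -> P a \/ P b].

Definition krull_chain (S J : DP -> Prop) (d : nat) : Prop :=
  exists c : nat -> DP -> Prop,
    (forall k, (k <= d)%N -> is_subprime S (c k) /\ forall p, J p -> c k p) /\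
    (forall k, (k < d)%N ->
       (forall p, c k p -> c k.+1 p) /\ exists p, c k.+1 p /\ ~ c k p).

Definition krull_dim (S J : DP -> Prop) (d : nat) : Prop :=
  krull_chain S J d /\ ~ krull_chain S J d.+1.

Definition is_dim_poly (I : DP -> Prop) (p : {poly rat}) : Prop :=
  exists N, forall l, (N <= l)%N ->
    exists d : nat, krull_dim (ord_le l) (fun q => I q /\ ord_le l q) d /\
                    p.[l%:R] = d%:R.

(* elements of quot(F{U}/I): fractions a/s, s not a zero divisor mod I *)
Definition dfrac := (DP * DP)%type.
Definition frac_ok (I : DP -> Prop) (x : dfrac) : Prop := nzd_mod I x.2.
Definition frac_eq (I : DP -> Prop) (x y : dfrac) : Prop := I (x.1 * y.2 - y.1 * x.2).
Definition frac_add (x y : dfrac) : dfrac := (x.1 * y.2 + y.1 * x.2, x.2 * y.2).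
Definition frac_mul (x y : dfrac) : dfrac := (x.1 * y.1, x.2 * y.2).
Definition frac_scale (c : F) (x : dfrac) : dfrac := (c *: x.1, x.2).
Definition frac_one : dfrac := (1, 1).
Definition frac_der (i : 'I_n) (x : dfrac) : dfrac :=
  (dder der i x.1 * x.2 - x.1 * dder der i x.2, x.2 * x.2).

End Charac.

(* binomial polynomial  l |-> C(l + i, i) *)
Definition binpoly (i : nat) : {poly rat} :=
  \prod_(j < i) (('X + (j.+1)%:R%:P) * ((j.+1)%:R^-1)%:P).

(* differential birational map F{U}/I --> F{V}/J: an F-algebra isomorphism
   quot(F{U}/I) -> quot(F{V}/J) commuting with the derivations, presented on
   representatives (fractions) of the total quotient rings *)
Definition diff_birational (F : fieldType) (n : nat) (der : 'I_n -> F -> F)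
  (m k : nat) (I : DP F n m -> Prop) (J : DP F n k -> Prop)
  (phi : dfrac F n m -> dfrac F n k) : Prop :=
  let okI := frac_ok I in let okJ := frac_ok J in
  let eI := frac_eq I in let eJ := frac_eq J in
  [/\ (forall x, okI x -> okJ (phi x)),
      (forall x y, okI x -> okI y -> eI x y <-> eJ (phi x) (phi y)),
      (forall y, okJ y -> exists2 x, okI x & eJ (phi x) y),
      (forall x y, okI x -> okI y ->
         eJ (phi (frac_add x y)) (frac_add (phi x) (phi y)) /\
         eJ (phi (frac_mul x y)) (frac_mul (phi x) (phi y))) &
      [/\ (forall c x, okI x -> eJ (phi (frac_scale c x)) (frac_scale c (phi x))),
      eJ (phi (frac_one F n m)) (frac_one F n k) &
      (forall i x, okI x ->
         eJ (phi (frac_der der i x)) (frac_der der i (phi x)))]].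

(* Main.v *)
Require Import Defs.
From HB Require Import structures.
From mathcomp Require Import all_boot all_order all_algebra.
From mathcomp Require Import finmap monalg.
From mathcomp Require Import ring lra.
From mathcomp Require boolp classical_sets.

Set Implicit Arguments.
Unset Strict Implicit.
Unset Printing Implicit Defensive.

Import Order.TTheory GRing.Theory Num.Theory.
Local Open Scope ring_scope.

(** A differential birational map commutes with the derivations, so it sends an
    element of F{U} of order at most l to a fraction b / s with b and s of order
    at most l + l0, where l0 does not depend on l.  Hence elements of F{U}_{<=l}
    that are algebraically independent modulo I yield as many independent
    fractions over F{V}_{<=l+l0} modulo J, and the dimension cannot decrease:
    - elements taken in the successive differences of a chain of primes are
      algebraically independent;
    - conversely, from d independent fractions over a finitely generated algebra,
      a chain of d + 1 primes is built by specializing one of them at a time to a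
      generic natural number; integrality over a localized polynomial ring shows
      that the others stay independent.
    By symmetry the two dimension polynomials satisfy
    omega_I(l) <= omega_J(l + l0) and omega_J(l) <= omega_I(l + l1) for large l,
    hence they have the same degree and the same leading coefficient. *)

(** * Prime ideals and residue fields *)

Section PrimeIdeals.

Variable R : comNzRingType.
Implicit Types I J M P Q : R -> Prop.

Definition ideal I : Prop :=
  [/\ I 0, (forall a b, I a -> I b -> I (a + b)) &
      (forall r a, I a -> I (r * a))].

Definition prime_ideal P : Prop :=
  [/\ ideal P, ~ P 1 & forall a b, P (a * b) -> P a \/ P b].

Definition prime_chain I (d : nat) : Prop :=
  exists c : nat -> R -> Prop,
    (forall k, (k <= d)%N -> prime_ideal (c k) /\ forall a, I a -> c k a) /\
    (forall k, (k < d)%N ->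
       (forall a, c k a -> c k.+1 a) /\ exists a, c k.+1 a /\ ~ c k a).

Definition multiplicatively_closed M : Prop :=
  M 1 /\ forall a b, M a -> M b -> M (a * b).

Definition avoids I M : Prop := forall a, I a -> ~ M a.

Definition maximal_avoiding M P : Prop :=
  [/\ ideal P, avoids P M &
      forall Q, ideal Q -> avoids Q M -> (forall a, P a -> Q a) ->
        forall a, Q a -> P a].

Lemma ideal_lincomb I a b u v : ideal I -> I u -> I v -> I (a * u + b * v).
Proof. by case=> _ ID IM Iu Iv; apply: ID; apply: IM. Qed.

Lemma prime_chain_subset I J d :
  (forall a, I a -> J a) -> prime_chain J d -> prime_chain I d.
Proof.
move=> IJ [c [c_prime c_strict]]; exists c; split=> // k /c_prime[ck Jc].
by split=> // a /IJ/Jc.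
Qed.

Lemma ideal_chain_union (T : Type) (C : T -> Prop) (S : T -> R -> Prop) :
  (exists s, C s) -> (forall s, C s -> ideal (S s)) ->
  (forall s t, C s -> C t ->
     (forall a, S s a -> S t a) \/ (forall a, S t a -> S s a)) ->
  ideal (fun a => exists2 s, C s & S s a).
Proof.
move=> [s0 Cs0] idS totS; split.
- by exists s0 => //; case: (idS s0 Cs0).
- move=> a b [s Cs sa] [t Ct tb].
  have [_ sD _] := idS s Cs; have [_ tD _] := idS t Ct.
  by case: (totS s t Cs Ct) => [st|ts]; [exists t => //; apply/tD/tb/st |
    exists s => //; apply/sD/ts/tb].
- by move=> r a [s Cs sa]; exists s => //; have [_ _ sM] := idS s Cs; apply: sM.
Qed.

Lemma exists_maximal_avoiding J M : ideal J -> avoids J M ->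
  exists P, maximal_avoiding M P /\ forall a, J a -> P a.
Proof.
move=> idJ JM.
pose good Q := [/\ ideal Q, avoids Q M & forall a, J a -> Q a].
pose leq_good (s t : {Q | good Q}) := boolp.asbool (forall a, sval s a -> sval t a).
have goodJ : good J by split.
case: (@classical_sets.ZL_preorder _ (exist good J goodJ) leq_good).
- by move=> s; apply/boolp.asboolP.
- move=> s r t /boolp.asboolP rs /boolp.asboolP st.
  by apply/boolp.asboolP=> a /rs/st.
- move=> C totC.
  have [[s0 Cs0]|C0] := boolp.pselect (exists s, C s); last first.
    by exists (exist good J goodJ) => s Cs; case: C0; exists s.
  pose U a := exists2 s : {Q | good Q}, C s & sval s a.
  suff goodU : good U.
    by exists (exist good U goodU) => s Cs; apply/boolp.asboolP=> a sa; exists s.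
  split.
  + apply: ideal_chain_union => [|s _|s t Cs Ct]; first by exists s0.
      by case: (svalP s).
    by have [/boolp.asboolP|/boolp.asboolP] := totC s t Cs Ct; [left | right].
  + by move=> a [s _ sa]; case: (svalP s) => _ + _; apply.
  + by move=> a Ja; exists s0 => //; case: (svalP s0) => _ _; apply.
move=> [P [idP PM JP]] maxP; exists P; do 2?split=> //.
move=> Q idQ QM PQ.
have goodQ : good Q by split=> // a /JP/PQ.
by have /boolp.asboolP := maxP (exist good Q goodQ) (boolp.asboolT PQ).
Qed.

Lemma maximal_avoiding_prime M P :
  multiplicatively_closed M -> maximal_avoiding M P -> prime_ideal P.
Proof.
move=> [M1 MM] [idP PM maxP]; have [P0 PD PMl] := idP.
have meets x : ~ P x -> exists a p, P p /\ M (p + a * x).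
  move=> nPx; apply: boolp.contrapT => no.
  pose Q b := exists a p, P p /\ b = p + a * x.
  apply/nPx/(maxP Q); [split| | |].
  - by exists 0, 0; split=> //; ring.
  - move=> _ _ [a [p [Pp ->]]] [b [q [Pq ->]]].
    by exists (a + b), (p + q); split; [exact: PD | ring].
  - move=> r _ [a [p [Pp ->]]].
    by exists (r * a), (r * p); split; [exact: PMl | ring].
  - by move=> _ [a [p [Pp ->]]] Mb; apply: no; exists a, p.
  - by move=> b Pb; exists 0, b; split=> //; ring.
  - by exists 1, 0; split=> //; ring.
split=> // [/PM//|a b Pab].
apply: boolp.contrapT => /boolp.not_orP[/meets[u [p [Pp Mp]]]].
move=> /meets[v [q [Pq Mq]]]; apply: (PM _ _ (MM _ _ Mp Mq)).
have -> : (p + u * a) * (q + v * b) =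
    (q + v * b) * p + (u * a * q + u * v * (a * b)) by ring.
by apply: (PD); [exact: PMl | exact: ideal_lincomb].
Qed.

End PrimeIdeals.

Lemma ker_prime (R : comNzRingType) (K : fieldType) (h : {rmorphism R -> K}) :
  prime_ideal (fun a => h a = 0).
Proof.
split; first split.
- exact: rmorph0.
- by move=> a b ha hb; rewrite rmorphD ha hb addr0.
- by move=> r a ha; rewrite rmorphM ha mulr0.
- by rewrite rmorph1; apply/eqP/oner_neq0.
- by move=> a b /eqP; rewrite rmorphM mulf_eq0 => /orP[] /eqP; [left|right].
Qed.

Section ResidueField.

Variables (R : comNzRingType) (P : R -> Prop) (primeP : prime_ideal P).

Definition prime_mem : pred R := fun a => boolp.asbool (P a).

Lemma prime_memP a : reflect (P a) (a \in prime_mem).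
Proof. exact: boolp.asboolP. Qed.

Lemma prime_mem_idealr_closed : idealr_closed prime_mem.
Proof.
case: primeP => -[P0 PD PM] P1 _; split; first exact/prime_memP.
  exact/prime_memP.
by move=> a u v /prime_memP Pu /prime_memP Pv; apply/prime_memP/PD => //; apply: PM.
Qed.

Lemma prime_mem_prime_closed : prime_idealr_closed prime_mem.
Proof.
case: primeP => _ _ PP u v /prime_memP /PP [] /prime_memP -> //.
by rewrite orbT.
Qed.

HB.instance Definition _ := isIdealr.Build R prime_mem prime_mem_idealr_closed.
HB.instance Definition _ :=
  isPrimeIdealrClosed.Build R prime_mem prime_mem_prime_closed.

Definition residue_ring := {ideal_quot [the prime_idealr R of prime_mem]}.
HB.instance Definition _ := GRing.ComNzRing.on residue_ring.

Definition residue_unit : pred residue_ring :=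
  fun x => boolp.asbool (exists y, y * x = 1).

Definition residue_inv (x : residue_ring) : residue_ring :=
  if boolp.pselect (exists y, y * x = 1) is left xV then sval (boolp.cid xV)
  else x.

Lemma residue_mulVr : {in residue_unit, left_inverse 1 residue_inv *%R}.
Proof.
move=> x /boolp.asboolP ux; rewrite /residue_inv.
by case: boolp.pselect => // xV; case: boolp.cid.
Qed.

Lemma residue_unitP (x y : residue_ring) : y * x = 1 -> residue_unit x.
Proof. by move=> yx; apply/boolp.asboolP; exists y. Qed.

Lemma residue_inv_out : {in [predC residue_unit], residue_inv =1 id}.
Proof.
by move=> x /boolp.asboolP ux; rewrite /residue_inv; case: boolp.pselect.
Qed.

HB.instance Definition _ := GRing.ComNzRing_hasMulInverse.Build residue_ring
  residue_mulVr residue_unitP residue_inv_out.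

Lemma residue_ring_integral (x y : residue_ring) :
  x * y = 0 -> (x == 0) || (y == 0).
Proof. exact: Quotient.rquot_IdomainAxiom. Qed.

HB.instance Definition _ := GRing.ComUnitRing_isIntegral.Build residue_ring
  residue_ring_integral.

Lemma exists_residue_field : exists (K : fieldType) (h : {rmorphism R -> K}),
  forall a, h a = 0 <-> P a.
Proof.
exists {fraction residue_ring},
  (@FracField.tofrac residue_ring \o (\pi_residue_ring)%qT) => a.
have piE : (\pi_residue_ring a == 0)%qT = (a \in prime_mem).
  by rewrite -(rmorph0 (\pi_residue_ring)%qT) -Quotient.idealrBE subr0.
split=> [/eqP|/prime_memP]; rewrite /= -?piE.
  by rewrite tofrac_eq0 piE => /prime_memP.
by move=> /eqP ->; rewrite rmorph0.
Qed.

End ResidueField.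

Lemma exists_field_avoiding (R : comNzRingType) (J M : R -> Prop) :
  ideal J -> multiplicatively_closed M -> avoids J M ->
  exists (K : fieldType) (h : {rmorphism R -> K}),
    (forall a, J a -> h a = 0) /\ (forall a, M a -> h a != 0).
Proof.
move=> idJ MM JM; have [P [maxP JP]] := exists_maximal_avoiding idJ JM.
have [K [h kerh]] := exists_residue_field (maximal_avoiding_prime MM maxP).
exists K, h; split=> [a /JP /kerh //|a Ma].
by apply/eqP=> /kerh Pa; case: maxP => _ PM _; apply: PM Ma.
Qed.

(** * Algebraic independence *)

Definition adjoin (D R : comNzRingType) (i : {rmorphism D -> R}) (x : R) :
  {rmorphism {poly D} -> R} := horner_morph (fun c => mulrC x (i c)).

Arguments adjoin : simpl never.

Section Adjoin.

Variables (D R : comNzRingType) (i : {rmorphism D -> R}) (x : R).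

Lemma adjoinE p : adjoin i x p = (map_poly i p).[x].
Proof. by []. Qed.

Lemma adjoinC c : adjoin i x c%:P = i c.
Proof. exact: horner_morphC. Qed.

Lemma adjoinX : adjoin i x 'X = x.
Proof. exact: horner_morphX. Qed.

Lemma adjoinMXaddC p c : adjoin i x (p * 'X + c%:P) = adjoin i x p * x + i c.
Proof. by rewrite rmorphD rmorphM adjoinX adjoinC. Qed.

End Adjoin.

Fixpoint iter_poly (D : idomainType) (d : nat) : idomainType :=
  if d is d'.+1 then {poly iter_poly D d'} else D.

(* The outermost variable of [iter_poly D d.+1] has index [d]. *)
Fixpoint iter_eval (D : idomainType) (R : comNzRingType)
    (f : {rmorphism D -> R}) (x : nat -> R) (d : nat) :
    {rmorphism iter_poly D d -> R} :=
  match d return {rmorphism iter_poly D d -> R} with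
  | 0 => f
  | d'.+1 => adjoin (iter_eval f x d') (x d')
  end.

Definition algebraically_independent (D : idomainType) (R : comNzRingType)
    (f : {rmorphism D -> R}) (I : R -> Prop) (x : nat -> R) (d : nat) : Prop :=
  forall e : iter_poly D d, I (iter_eval f x d e) -> e = 0.

Section IteratedPolynomials.

Variables (D : idomainType) (R R' : comNzRingType).
Variables (f : {rmorphism D -> R}) (f' : {rmorphism D -> R'}).

Lemma iter_eval_rel (S : R -> R' -> Prop) x x' d :
  (forall a a' b b', S a a' -> S b b' -> S (a + b) (a' + b')) ->
  (forall a a' b b', S a a' -> S b b' -> S (a * b) (a' * b')) ->
  (forall c, S (f c) (f' c)) -> (forall j, (j < d)%N -> S (x j) (x' j)) ->
  forall e, S (iter_eval f x d e) (iter_eval f' x' d e).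
Proof.
move=> SD SM Sf; elim: d => [|d IH] Sx e; first exact: Sf.
have {}IH e' : S (iter_eval f x d e') (iter_eval f' x' d e').
  by apply: IH => j /ltnW; apply: Sx.
elim/poly_ind: e => [|p e Sp]; first by have := Sf 0; rewrite !rmorph0.
by rewrite /= !adjoinMXaddC; apply: SD => //; apply: SM => //; apply: Sx.
Qed.

Lemma iter_eval_const x d c : exists e, iter_eval f x d e = f c.
Proof.
by elim: d => [|d [e <-]]; [exists c | exists e%:P; rewrite /= adjoinC].
Qed.

End IteratedPolynomials.

Lemma eq_iter_eval (D : idomainType) (R : comNzRingType)
    (f f' : {rmorphism D -> R}) x x' d :
  f =1 f' -> (forall j, (j < d)%N -> x j = x' j) ->
  iter_eval f x d =1 iter_eval f' x' d.
Proof.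
by move=> ff'; apply: (iter_eval_rel (S := eq)) => [? ? ? ? -> ->|? ? ? ? -> ->|].
Qed.

Lemma eq_algebraically_independent (D : idomainType) (R : comNzRingType)
    (f f' : {rmorphism D -> R}) I x d :
  f =1 f' -> algebraically_independent f I x d ->
  algebraically_independent f' I x d.
Proof.
by move=> ff' indep e; rewrite -(eq_iter_eval (x := x) ff') //; apply: indep.
Qed.

Lemma iter_eval_comp (D : idomainType) (R R' : comNzRingType)
    (f : {rmorphism D -> R}) (h : {rmorphism R -> R'}) x d e :
  iter_eval (h \o f) (h \o x) d e = h (iter_eval f x d e).
Proof.
apply: (iter_eval_rel (S := fun a b => a = h b)) => //.
  by move=> _ a _ b -> ->; rewrite rmorphD.
by move=> _ a _ b -> ->; rewrite rmorphM.
Qed.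

(* Choosing [x] in the successive differences of the chain, a polynomial
   relation is peeled off variable by variable: divide by the largest power of
   the outermost variable, then reduce modulo the next prime. *)
Lemma prime_chain_independent (F : fieldType) (R : comNzRingType)
    (f : {rmorphism F -> R}) (I : R -> Prop) d :
  prime_chain I d -> exists x, algebraically_independent f I x d.
Proof.
case=> c [c_prime c_strict].
suff [x indep] : exists x, algebraically_independent f (c 0%N) x d.
  by exists x => e Ie; apply: indep; apply: (c_prime 0%N isT).2.
have {c_prime} : forall k, (k <= d)%N -> prime_ideal (c k) by move=> k /c_prime[].
elim: d c c_strict => [|d IH] c c_strict c_prime.
  exists (fun=> 0) => /= e ce; apply/eqP/negPn/negP => en0.
  have [[_ _ cM] c1 _] := c_prime 0%N isT; apply: c1.
  by rewrite -(rmorph1 f) -(mulVf en0) rmorphM; apply: cM.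
have [k /(c_strict k.+1) //|k /(c_prime k.+1) //|x indep] :=
  IH (fun k => c k.+1).
have [sub01 [a [c1a c0a]]] := c_strict 0%N isT.
have [[_ c1D c1M] _ _] := c_prime 1%N isT; have [_ _ c0P] := c_prime 0%N isT.
exists (fun j => if j == d then a else x j); set x' := fun j => _.
have x'x : iter_eval f x' d =1 iter_eval f x d.
  by apply: eq_iter_eval => // j lt_jd; rewrite /x' ltn_eqF.
rewrite /algebraically_independent /= /x' eqxx.
elim/poly_ind => // p e IHp; rewrite adjoinMXaddC => c0pe.
have e0 : e = 0.
  apply: indep; rewrite -x'x.
  have -> : iter_eval f x' d e =
      (adjoin (iter_eval f x' d) a p * a + iter_eval f x' d e) +
      - adjoin (iter_eval f x' d) a p * a by ring.
  by apply: c1D; [exact: sub01 | exact: c1M].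
move: c0pe; rewrite e0 rmorph0 addr0 => /c0P[/IHp ->|//].
by rewrite mul0r add0r.
Qed.

(** * Generated subalgebras *)

Section Generated.

Variables (D R : comNzRingType) (f : {rmorphism D -> R}).

Definition subalgebra (S : R -> Prop) : Prop :=
  [/\ (forall a b, S a -> S b -> S (a + b)),
      (forall a b, S a -> S b -> S (a * b)) & (forall c, S (f c))].

Definition generated (ys : seq R) (a : R) : Prop :=
  forall S, subalgebra S -> (forall y, y \in ys -> S y) -> S a.

Lemma generated_subalgebra ys : subalgebra (generated ys).
Proof.
split=> [a b ga gb|a b ga gb|c] S subS Sys; have [SD SM Sf] := subS.
- by apply: SD; [apply: ga | apply: gb].
- by apply: SM; [apply: ga | apply: gb].
- exact: Sf.
Qed.

Lemma mem_generated ys y : y \in ys -> generated ys y.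
Proof. by move=> yys S _; apply. Qed.

End Generated.

Lemma generated_rmorph (D D' R R' : comNzRingType) (f : {rmorphism D -> R})
    (f' : {rmorphism D' -> R'}) (h : {rmorphism R -> R'}) ys zs a :
  (forall c, generated f' zs (h (f c))) ->
  (forall y, y \in ys -> generated f' zs (h y)) ->
  generated f ys a -> generated f' zs (h a).
Proof.
move=> fz yz /(_ (fun a => generated f' zs (h a))); apply=> //.
have [SD SM _] := generated_subalgebra f' zs.
by split=> // u v gu gv; [rewrite rmorphD; apply: SD | rewrite rmorphM; apply: SM].
Qed.

(** * Independence of fractions *)

Section FractionRelation.

Variables (F : idomainType) (A R : comNzRingType).
Variables (fA : {rmorphism F -> A}) (fR : {rmorphism F -> R}).
(* [T p r t] reads: p corresponds to the fraction r / t. *)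
Variable T : A -> R -> R -> Prop.

Definition fraction_relation : Prop :=
  [/\ (forall p r t p' r' t', T p r t -> T p' r' t' ->
         T (p + p') (r * t' + r' * t) (t * t')),
      (forall p r t p' r' t', T p r t -> T p' r' t' ->
         T (p * p') (r * r') (t * t')),
      (forall c, T (fA c) (fR c) 1) &
      (forall p r t, T p r t -> T 1 t t)].

Lemma exists_independent_residue (J : R -> Prop) d (x : nat -> A) (b s : nat -> R) :
  fraction_relation -> ideal J -> (forall j, (j < d)%N -> T (x j) (b j) (s j)) ->
  (forall e r t, T (iter_eval fA x d e) r t -> J r -> e = 0) ->
  exists (K : fieldType) (h : {rmorphism R -> K}),
    [/\ forall a, J a -> h a = 0, forall j, (j < d)%N -> h (s j) != 0 &
        algebraically_independent (h \o fR) (eq^~ 0)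
          (fun j => h (b j) / h (s j)) d].
Proof.
move=> [TD TM TC T1] idJ Tx Jindep.
pose M r := exists e t, e != 0 /\ T (iter_eval fA x d e) r t.
have [|u Ju [e [t [en0 Tu]]]|K [h [hJ hM]]] := exists_field_avoiding (M := M) idJ.
- split=> [|u v [e [t [en0 Tu]]] [e' [t' [en0' Tv]]]].
    by exists 1, 1; split; [exact: oner_neq0 | have := TC 1; rewrite !rmorph1].
  exists (e * e'), (t * t').
  by rewrite mulf_neq0 // rmorphM; split=> //; apply: TM.
- by rewrite (Jindep e u t Tu Ju) eqxx in en0.
have h_denom p r t : T p r t -> h t != 0.
  move=> /T1 Tt; apply: hM; exists 1, t; split; first exact: oner_neq0.
  by rewrite rmorph1.
exists K, h; split=> // [j /Tx /h_denom //|e ez0].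
pose S p z := exists r t, T p r t /\ z = h r / h t.
have [r [t [Tr]]] :
    S (iter_eval fA x d e) (iter_eval (h \o fR) (fun j => h (b j) / h (s j)) d e).
  apply: iter_eval_rel => [p z p' z'|p z p' z'|c|j lt_jd].
  - move=> [r [t [Tr ->]]] [r' [t' [Tr' ->]]].
    exists (r * t' + r' * t), (t * t'); split; first exact: TD.
    by rewrite rmorphD !rmorphM addf_div ?(h_denom _ _ _ Tr) ?(h_denom _ _ _ Tr').
  - move=> [r [t [Tr ->]]] [r' [t' [Tr' ->]]].
    by exists (r * r'), (t * t'); split; [exact: TM | rewrite !rmorphM mulf_div].
  - by exists (fR c), 1; rewrite rmorph1 divr1.
  - by exists (b j), (s j); split; first exact: Tx.
rewrite ez0 => /esym/eqP; rewrite mulf_eq0 invr_eq0 (negPf (h_denom _ _ _ Tr)) orbF.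
by apply: contraTeq => en0; apply: hM; exists e, t.
Qed.

End FractionRelation.

(** * Transcendental elements and integrality *)

Section Transcendence.

Variable K : fieldType.

(* As [i] need not be injective, transcendence is over the subring [i D]. *)
Definition transcendental (D : comNzRingType) (i : {rmorphism D -> K}) (x : K) :=
  forall p : {poly D}, adjoin i x p = 0 -> map_poly i p = 0.

Definition algebraic_over (D : comNzRingType) (i : {rmorphism D -> K}) (y : K) :=
  exists2 q : {poly D}, map_poly i q != 0 & root (map_poly i q) y.

Lemma adjoin_swapXY (D : comNzRingType) (i : {rmorphism D -> K}) x y
    (p : {poly {poly D}}) :
  adjoin (adjoin i x) y (swapXY p) = adjoin (adjoin i y) x p.
Proof.
have adjoin2E u v (q : {poly {poly D}}) :
    adjoin (adjoin i u) v q = (map_poly (map_poly i) q).[v, u].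
  have -> : adjoin (adjoin i u) v q =
      (map_poly (horner_eval u) (map_poly (map_poly i) q)).[v].
    by rewrite -map_poly_comp.
  by rewrite -{1}[v](hornerC v u) -/(horner_eval u _) horner_map.
by rewrite !adjoin2E -swapXY_map horner2_swapXY.
Qed.

Lemma transcendental_exchange (D : comNzRingType) (i : {rmorphism D -> K}) x y :
  transcendental i x ->
  transcendental (adjoin i y) x \/ algebraic_over (adjoin i x) y.
Proof.
move=> tx; have [|ntx] := boolp.pselect (transcendental (adjoin i y) x).
  by left.
right; move/boolp.existsNP: ntx => [p /boolp.not_implyP[px0 /eqP pn0]].
exists (swapXY p); last by apply/eqP; rewrite -[RHS]px0 -adjoin_swapXY.
apply: contra_neq pn0 => /polyP swap_p0.
suff p0 : map_poly (map_poly i) p = 0.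
  apply/polyP=> j; rewrite coef_map coef0 [LHS]adjoinE.
  by move/polyP: p0 => /(_ j); rewrite coef_map coef0 => ->; rewrite horner0.
apply/eqP; rewrite -swapXY_eq0 swapXY_map; apply/eqP/polyP => j.
by rewrite coef_map coef0; apply: tx; have := swap_p0 j; rewrite coef_map coef0.
Qed.

Lemma transcendental_neq (D : comNzRingType) (i : {rmorphism D -> K}) x c :
  transcendental i x -> x != i c.
Proof.
move=> tx; apply/eqP=> xc; have /tx/eqP : adjoin i x ('X - c%:P) = 0.
  by rewrite rmorphB /= adjoinX adjoinC xc subrr.
by apply/negP; rewrite rmorphB /= map_polyX map_polyC monic_neq0 // monicXsubC.
Qed.

Lemma extend_to_algebraic_adjoin (ys : seq K) x (D : comNzRingType)
    (i : {rmorphism D -> K}) :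
  transcendental i x ->
  exists (D' : comNzRingType) (i' : {rmorphism D' -> K}) (j : {rmorphism D -> D'}),
    [/\ forall d, i' (j d) = i d, transcendental i' x &
        forall y, y \in ys -> algebraic_over (adjoin i' x) y].
Proof.
elim: ys D i => [|y ys IH] D i tx; first by exists D, i, idfun.
have [ty|[q qn0 qy]] := transcendental_exchange y tx.
  have [D' [i' [j [ji tx' alg]]]] := IH _ _ ty.
  exists D', i', (j \o polyC); split=> // [d|z]; first by rewrite /= ji adjoinC.
  rewrite inE => /predU1P[->|/alg //]; exists ('X - (j 'X)%:P%:P).
    by rewrite rmorphB /= map_polyX map_polyC /= monic_neq0 // monicXsubC.
  rewrite rmorphB /= map_polyX map_polyC /= root_XsubC.
  by rewrite (adjoinC i' x) ji adjoinX.
have [D' [i' [j [ji tx' alg]]]] := IH _ _ tx.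
exists D', i', j; split=> // z; rewrite inE => /predU1P[->|/alg //].
suff qE : map_poly (adjoin i' x) (map_poly (map_poly j) q) =
    map_poly (adjoin i x) q.
  by exists (map_poly (map_poly j) q); rewrite qE.
rewrite -map_poly_comp; apply: eq_map_poly => c /=.
by rewrite !adjoinE -map_poly_comp; congr _.[_]; apply: eq_map_poly.
Qed.

Section Integrality.

Variables (D : comNzRingType) (r : {rmorphism D -> K}).

Lemma algebraic_over_integral_multiple y :
  algebraic_over r y -> exists2 a, r a != 0 & integralOver r (r a * y).
Proof.
case=> q; set Q := map_poly r q => Qn0 Qy.
have [t szQ] : exists t, size Q = t.+2.
  by have := root_size_gt1 Qn0 Qy; case: (size Q) => [|[|t]] // _; exists t.
have rE j : r q`_j = Q`_j by rewrite coef_map.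
exists q`_t.+1.
  by rewrite rE -[t.+1]/(t.+2.-1) -szQ -lead_coefE lead_coef_eq0.
rewrite rE; set l := Q`_t.+1.
pose P : {poly K} := 'X^(t.+1) + \poly_(j < t.+1) (Q`_j * l ^+ (t - j)).
apply: (@integral_root_monic _ _ _ _ P).
- by rewrite monicE lead_coefDl ?lead_coefXn // size_polyXn ltnS size_poly.
- apply/rootP; rewrite hornerD hornerXn horner_poly.
  move/rootP: Qy; rewrite horner_coef szQ big_ord_recr /= -/l => Qy.
  transitivity (l ^+ t * (\sum_(j < t.+1) Q`_j * y ^+ j + l * y ^+ t.+1)).
    rewrite mulrDr mulr_sumr exprMn exprSr addrC mulrA; congr (_ + _).
    apply: eq_bigr => j _; rewrite exprMn.
    have -> : l ^+ t = l ^+ (t - j) * l ^+ j by rewrite -exprD subnK // -ltnS.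
    by ring.
  by rewrite Qy mulr0.
- apply/integral_poly=> j; rewrite coefD coefXn coef_poly.
  apply: integral_add; first exact: integral_nat.
  case: ifP => _; last exact: integral0.
  by rewrite /l -!rE -rmorphXn -rmorphM; apply: integral_id.
Qed.

Lemma integral_common_multiple (ys : seq K) :
  (forall y, y \in ys -> algebraic_over r y) ->
  exists2 a, r a != 0 & forall y, y \in ys -> integralOver r (r a * y).
Proof.
elim: ys => [|y ys IH] alg; first by exists 1; rewrite ?rmorph1 ?oner_eq0.
have [z zys|b bn0 ib] := IH; first by apply: alg; rewrite inE zys orbT.
have [a an0 ia] := algebraic_over_integral_multiple (alg y (mem_head _ _)).
exists (a * b); first by rewrite rmorphM mulf_neq0.
move=> z; rewrite inE rmorphM => /predU1P[->|/ib iz].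
  by rewrite mulrAC; apply: integral_mul => //; apply: integral_id.
by rewrite -mulrA; apply: integral_mul => //; apply: integral_id.
Qed.

Lemma generated_integral_multiple (D0 : comNzRingType) (i : {rmorphism D0 -> K})
    (ys : seq K) a z :
  (forall d, integralOver r (i d)) ->
  (forall y, y \in ys -> integralOver r (r a * y)) ->
  generated i ys z -> exists M, integralOver r (r a ^+ M * z).
Proof.
move=> int_i int_ys /(_ (fun z => exists M, integralOver r (r a ^+ M * z))).
apply=> [|y /int_ys iy]; last by exists 1%N.
have int_exp M w : integralOver r w -> integralOver r (r a ^+ M * w).
  by move=> iw; rewrite -rmorphXn; apply: integral_mul => //; apply: integral_id.
split=> [u v [M iu] [N iv]|u v [M iu] [N iv]|d].
- exists (M + N)%N; rewrite mulrDr exprD; apply: integral_add.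
    by rewrite mulrAC mulrC; apply: int_exp.
  by rewrite -mulrA; apply: int_exp.
- by exists (M + N)%N; rewrite exprD mulrACA; apply: integral_mul.
- by exists 0%N; rewrite mul1r.
Qed.

End Integrality.

(* Homogenize a monic equation of z in p and X - c; as x is transcendental, it
   remains true at x = c, where only the power of p survives. *)
Lemma root_of_integral_quotient (D : comNzRingType) (i : {rmorphism D -> K}) x
    (p : {poly D}) c z :
  transcendental i x -> integralOver (adjoin i x) z ->
  (x - i c) * z = adjoin i x p -> root (map_poly i p) (i c).
Proof.
move=> tx [q /monicP lead_q /rootP qz] xcz.
have [t szq] : exists t, size q = t.+1.
  exists (size q).-1; rewrite prednK // lt0n size_poly_eq0; apply/eqP=> q0.
  by move/eqP: lead_q; rewrite q0 lead_coef0 eq_sym oner_eq0.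
pose G : {poly D} := \sum_(k < t.+1) q`_k * ('X - c%:P) ^+ (t - k) * p ^+ k.
have GE y : adjoin i y G =
    \sum_(k < t.+1) adjoin i y q`_k * (y - i c) ^+ (t - k) * adjoin i y p ^+ k.
  rewrite rmorph_sum /=; apply: eq_bigr => k _.
  by rewrite !rmorphM !rmorphXn rmorphB adjoinX adjoinC.
have /tx G0 : adjoin i x G = 0.
  rewrite GE; transitivity ((x - i c) ^+ t * (map_poly (adjoin i x) q).[z]).
    rewrite (horner_coef_wide _ (_ : size (map_poly (adjoin i x) q) <= t.+1)%N).
      rewrite mulr_sumr; apply: eq_bigr => k _; rewrite -xcz coef_map exprMn.
      have -> : (x - i c) ^+ t = (x - i c) ^+ (t - k) * (x - i c) ^+ k.
        by rewrite -exprD subnK // -ltnS.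
      ring.
    by rewrite -szq; apply: size_poly.
  by rewrite qz mulr0.
have : adjoin i (i c) G = 0 by rewrite adjoinE G0 horner0.
rewrite GE big_ord_recr /= big1 ?add0r => [|k _]; last first.
  by rewrite subrr expr0n subn_eq0 leqNgt ltn_ord mulr0 mul0r.
have -> : q`_t = 1 by rewrite -lead_q lead_coefE szq.
rewrite rmorph1 mul1r subnn expr0 mul1r => /eqP.
by rewrite expf_eq0 => /andP[_].
Qed.

Lemma exists_natr_nonroot (p : {poly K}) :
  [pchar K] =i pred0 -> p != 0 -> exists c : nat, ~~ root p c%:R.
Proof.
move=> /pcharf0P char0 pn0; apply: boolp.contrapT => /boolp.forallNP roots.
have natr_inj_le u v : (u <= v)%N -> u%:R = v%:R :> K -> u = v.
  move=> le_uv /esym/eqP; rewrite -subr_eq0 -natrB // char0 subn_eq0 => le_vu.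
  by apply/eqP; rewrite eqn_leq le_uv.
have natr_inj : injective (fun c : nat => c%:R : K).
  move=> u v e; have [/natr_inj_le|/ltnW/natr_inj_le] := leqP u v; first exact.
  by move=> eq_vu; apply/esym/eq_vu/esym.
suff : (size [seq c%:R : K | c <- iota 0 (size p)] < size p)%N.
  by rewrite size_map size_iota ltnn.
apply: max_poly_roots => //; last by rewrite map_inj_uniq // iota_uniq.
by apply/allP=> _ /mapP[c _ ->]; apply/negPn/negP/roots.
Qed.

(* Over some extension D' of D, the [ys] have a common denominator in D'[x], a
   polynomial in x: c is chosen off its roots. *)
Lemma generic_specialization (D : comNzRingType) (i : {rmorphism D -> K}) x
    (ys : seq K) :
  [pchar K] =i pred0 -> transcendental i x ->
  exists c : nat, x != c%:R /\
    forall z d, generated i ys z -> (x - c%:R) * z = i d -> i d = 0.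
Proof.
move=> char0 tx.
have [D' [i' [j [ji tx' alg]]]] := extend_to_algebraic_adjoin ys tx.
have [a an0 int_ys] := integral_common_multiple alg.
have an0' : map_poly i' a != 0.
  by apply: contraNneq an0 => a0; rewrite adjoinE a0 horner0.
have [c nroot_c] := exists_natr_nonroot char0 an0'.
exists c; rewrite -(rmorph_nat i'); split=> [|z d gen_z xcz].
  exact: transcendental_neq.
have [e|M int_z] := generated_integral_multiple _ int_ys gen_z.
  by rewrite -ji -(adjoinC i' x); apply: integral_id.
have /(root_of_integral_quotient tx' int_z) :
    (x - i' c%:R) * (adjoin i' x a ^+ M * z) = adjoin i' x (a ^+ M * (j d)%:P).
  by rewrite rmorphM rmorphXn adjoinC ji -xcz mulrCA.
rewrite rmorph_nat rmorphM rmorphXn /= map_polyC rootE hornerM horner_exp.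
by rewrite hornerC /= ji mulf_eq0 expf_eq0 -rootE (negPf nroot_c) andbF => /eqP.
Qed.

End Transcendence.

(** * Chains of primes from independent fractions *)

Section FieldSubalgebra.

Variables (R : comNzRingType) (K : fieldType) (h : {rmorphism R -> K}).
Variable L : K -> Prop.
Hypothesis subL : subalgebra h L.

Lemma ideal_preimage_multiples u : ideal (fun a => exists2 y, L y & h a = u * y).
Proof.
have [LD LM Lh] := subL; split=> [|a b [y Ly aE] [z Lz bE]|r a [y Ly aE]].
- by exists 0; [rewrite -(rmorph0 h) | rewrite rmorph0 mulr0].
- by exists (y + z); [exact: LD | rewrite rmorphD aE bE mulrDr].
- by exists (h r * y); [exact: LM (Lh r) Ly | rewrite rmorphM aE mulrCA].
Qed.

Lemma fraction_relation_field (F : idomainType) (f : {rmorphism F -> R}) :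
  fraction_relation (h \o f) f
    (fun p r t => [/\ h t != 0, L (h t)^-1 & p = h r / h t]).
Proof.
have [_ LM Lh] := subL; split.
- move=> _ r t _ r' t' [tn0 Lt ->] [tn0' Lt' ->].
  split; rewrite ?rmorphM ?mulf_neq0 ?invfM //; first exact: LM.
  by rewrite rmorphD !rmorphM addf_div // invfM.
- move=> _ r t _ r' t' [tn0 Lt ->] [tn0' Lt' ->].
  split; rewrite ?rmorphM ?mulf_neq0 //; last by rewrite mulf_div.
  by rewrite invfM; exact: LM.
- move=> c; split; rewrite rmorph1 ?oner_neq0 ?invr1 ?mulr1 //.
  by rewrite -(rmorph1 h).
- by move=> _ r t [tn0 Lt _]; split=> //; rewrite divff.
Qed.

End FieldSubalgebra.

Section ChainConstruction.

Variables (F : fieldType) (R : comNzRingType) (f : {rmorphism F -> R}).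
Variables (gs : seq R) (b s : nat -> R).
Hypothesis char0 : [pchar F] =i pred0.
Hypothesis R_generated : forall a, generated f gs a.

(* Specializing the last fraction to a generic integer keeps the others
   independent. *)
Lemma exists_independent_specialization d (K : fieldType) (h : {rmorphism R -> K}) :
  (forall j, (j < d.+1)%N -> h (s j) != 0) ->
  algebraically_independent (h \o f) (eq^~ 0) (fun j => h (b j) / h (s j)) d.+1 ->
  exists (K' : fieldType) (h' : {rmorphism R -> K'}),
    [/\ forall a, h a = 0 -> h' a = 0, exists a, h' a = 0 /\ h a <> 0,
        forall j, (j < d)%N -> h' (s j) != 0 &
        algebraically_independent (h' \o f) (eq^~ 0)
          (fun j => h' (b j) / h' (s j)) d].
Proof.
set z := fun j => h (b j) / h (s j) => s_neq0 indep.
pose i := iter_eval (h \o f) z d.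
have i_inj e : i e = 0 -> e = 0.
  move=> ie0; apply/eqP; rewrite -polyC_eq0; apply/eqP/indep.
  by rewrite /= adjoinC.
have tz : transcendental i (z d) by move=> p /indep ->; rewrite rmorph0.
have charK : [pchar K] =i pred0.
  by move=> p; rewrite -(char0 p) (fmorph_pchar (h \o f)).
pose ys := [seq h g | g <- gs] ++ [seq (h (s j))^-1 | j <- iota 0 d.+1].
have [c [zc spec]] := generic_specialization ys charK tz.
pose L := generated i ys; have [LD LM Li] := generated_subalgebra i ys.
have Lh a : L (h a).
  apply: generated_rmorph (R_generated a) => [e|g ggs].
    have [e' eE] := iter_eval_const (h \o f) z d e.
    by rewrite -[h (f e)]eE; apply: Li.
  by apply: mem_generated; rewrite mem_cat map_f.
have subL : subalgebra h L by split.
have Linv j : (j < d.+1)%N -> L (h (s j))^-1.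
  move=> lt_jd; apply: mem_generated; rewrite mem_cat orbC.
  by rewrite (map_f (fun j => (h (s j))^-1)) // mem_iota.
have [j lt_jd|e r t [tn0 Lt ez] [y Ly rE]|K' [h' [h'J h's indep']]] :=
    exists_independent_residue (d := d) (x := z) (b := b) (s := s)
      (fraction_relation_field subL f) (ideal_preimage_multiples subL (z d - c%:R)).
- by split; [apply: s_neq0 (ltnW _) | apply: Linv (ltnW _) |].
- by apply/i_inj/(spec (y / h t)); [exact: LM Ly Lt | rewrite mulrA -rE -ez].
exists K', h'; split=> //.
  by move=> a ha; apply: h'J; exists 0; rewrite ?mulr0 // -(rmorph0 h).
have h_num : h (b d - c%:R * s d) = (z d - c%:R) * h (s d).
  by rewrite mulrBl divfK ?s_neq0 // rmorphB rmorphM rmorph_nat.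
exists (b d - c%:R * s d); split; first by apply: h'J; exists (h (s d)).
by apply/eqP; rewrite h_num mulf_neq0 ?subr_eq0 ?s_neq0.
Qed.

Lemma independent_prime_chain d (K : fieldType) (h : {rmorphism R -> K}) :
  (forall j, (j < d)%N -> h (s j) != 0) ->
  algebraically_independent (h \o f) (eq^~ 0) (fun j => h (b j) / h (s j)) d ->
  prime_chain (fun a => h a = 0) d.
Proof.
elim: d K h => [|d IH] K h s_neq0 indep.
  by exists (fun=> fun a => h a = 0); split=> // k _; split=> //; apply: ker_prime.
have [K' [h' [hh' [a [h'a ha]] s_neq0' indep']]] :=
  exists_independent_specialization s_neq0 indep.
have [c [c_prime c_strict]] := IH K' h' s_neq0' indep'.
exists (fun k => if k is k'.+1 then c k' else fun a => h a = 0).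
split=> -[|k] lt_kd.
- by split=> //; apply: ker_prime.
- by have [ck h'c] := c_prime k lt_kd; split=> // u /hh' /h'c.
- have [_ h'c] := c_prime 0%N isT; split=> [u /hh' /h'c //|].
  by exists a; split=> //; apply: h'c.
- exact: c_strict.
Qed.

End ChainConstruction.

(** * Differential polynomials *)

Local Notation scalars A := (in_alg A : {rmorphism _ -> A}).

Lemma malg_ind (K : choiceType) (G : zmodType) (P : {malg G[K]} -> Prop) :
  P 0 -> (forall p q, P p -> P q -> P (p + q)) ->
  (forall c k, P << c *g k >>) -> forall p, P p.
Proof. by move=> P0 PD PU p; rewrite (monalgE p); apply: (big_ind P). Qed.

Lemma cmonom_ind (I : choiceType) (P : {cmonom I} -> Prop) :
  P mone -> (forall x k, P k -> P (mmul (ucm x) k)) -> forall k, P k.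
Proof.
move=> P1 PM k; have [d] := ubnP (mdeg k); elim: d k => // d IH k lt_kd.
have [->//|kn1] := eqVneq k mone.
have /fset0Pn[x xk] : finsupp k != fset0.
  by apply: contraNneq kn1 => k0; rewrite -mdeg_eq0 mdegE k0 big_seq_fset0.
have kE : k = mmul (ucm x) (divcm k (ucm x)).
  apply/eqP/cmP => y; rewrite cmM divcmE cmU subnKC //.
  by case: eqVneq => // <-; rewrite lt0n cmE_neq0.
rewrite kE; apply/PM/IH; move: lt_kd.
by rewrite {1}kE mdegM mdegU add1n ltnS.
Qed.

Section MonoidAlgebra.

Variables (K : conomType) (A : comNzRingType).

Lemma malgUM (c c' : A) (k k' : K) :
  << c *g k >> * << c' *g k' >> = << c * c' *g mmul k k' >> :> {malg A[K]}.
Proof. by rewrite malgM_def fgmulUU. Qed.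

Lemma malgU1M (k k' : K) : << k >> * << k' >> = << mmul k k' >> :> {malg A[K]}.
Proof. by rewrite malgUM mulr1. Qed.

Lemma malgUZ (c : A) (k : K) : << c *g k >> = c *: << k >> :> {malg A[K]}.
Proof. by apply/malgP=> k'; rewrite mcoeffZ !mcoeffU mulrnAr mulr1. Qed.

End MonoidAlgebra.

Section BoundedOrder.

Variables (F : fieldType) (n m : nat).
Local Notation R := (DP F n m).
Implicit Types p q : R.

Definition ord_le_pred l : {pred R} := fun p => boolp.asbool (ord_le l p).

Lemma ord_leP l p : reflect (ord_le l p) (p \in ord_le_pred l).
Proof. exact: boolp.asboolP. Qed.

Lemma ord_leW l l' p : (l <= l')%N -> ord_le l p -> ord_le l' p.
Proof. by move=> le_ll' pl k kp x xk; apply: leq_trans le_ll'; apply: pl xk. Qed.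

Lemma exists_ord_le p : exists l, ord_le l p.
Proof.
pose deg (k : {cmonom (dvar n m)}) := \max_(x <- finsupp k) ordv x.
exists (\max_(k <- msupp p) deg k) => k kp x xk.
apply: leq_trans (leq_bigmax_seq (F := deg) _ kp isT).
exact: leq_bigmax_seq xk isT.
Qed.

Lemma ord_leU l c (k : {cmonom (dvar n m)}) :
  (forall x, x \in finsupp k -> (ordv x <= l)%N) -> ord_le l (<< c *g k >> : R).
Proof. by move=> kl k' /(fsubsetP msuppU_le); rewrite in_fset1 => /eqP ->. Qed.

Lemma ord_le_Xv l (x : dvar n m) : (ordv x <= l)%N -> ord_le l (Xv F x).
Proof. by move=> xl; apply: ord_leU => y; rewrite mdomU in_fset1 => /eqP ->. Qed.

Lemma ord_le_subalg_closed l : subalg_closed (ord_le_pred l).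
Proof.
split=> [|c p q /ord_leP pl /ord_leP ql|p q /ord_leP pl /ord_leP ql]; apply/ord_leP.
- by apply: ord_leU => x; rewrite mdom1.
- move=> k /(fsubsetP (msuppD_le _ _)); rewrite in_fsetU => /orP[|/ql //].
  by move/(fsubsetP (msuppZ_le _ _)) => /pl.
- move=> k /msuppM_le [k1 [k2 [/pl k1l /ql k2l ->]]] x.
  by rewrite mdomD in_fsetU => /orP[/k1l|/k2l].
Qed.

HB.instance Definition _ l := GRing.isSubalgClosed.Build F R (ord_le_pred l)
  (ord_le_subalg_closed l).

Lemma ord_leD l p q : ord_le l p -> ord_le l q -> ord_le l (p + q).
Proof. by move=> /ord_leP pl /ord_leP ql; apply/ord_leP/rpredD. Qed.

Lemma ord_leB l p q : ord_le l p -> ord_le l q -> ord_le l (p - q).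
Proof. by move=> /ord_leP pl /ord_leP ql; apply/ord_leP/rpredB. Qed.

Lemma ord_leM l p q : ord_le l p -> ord_le l q -> ord_le l (p * q).
Proof. by move=> /ord_leP pl /ord_leP ql; apply/ord_leP/rpredM. Qed.

Record DP_le l := DPLe { DP_le_val : R; _ : DP_le_val \in ord_le_pred l }.

HB.instance Definition _ l := [isSub for @DP_le_val l].
HB.instance Definition _ l := [Choice of DP_le l by <:].
HB.instance Definition _ l := [SubChoice_isSubComNzRing of DP_le l by <:].
HB.instance Definition _ l := [SubZmodule_isSubLmodule of DP_le l by <:].
HB.instance Definition _ l :=
  [SubNzRing_SubLmodule_isSubLalgebra of DP_le l by <:].

Lemma DP_leP l (a : DP_le l) : ord_le l (val a).
Proof. exact/ord_leP/valP. Qed.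

Lemma ord_le_DP_le l p : ord_le l p -> exists a : DP_le l, val a = p.
Proof. by move=> /ord_leP pl; exists (DPLe pl). Qed.

Lemma val_scalars l c : val (scalars (DP_le l) c) = scalars R c.
Proof. by rewrite [LHS]linearZ. Qed.

Lemma ord_le_ind l (S : R -> Prop) :
  subalgebra (scalars R) S -> (forall x, (ordv x <= l)%N -> S (Xv F x)) ->
  forall p, ord_le l p -> S p.
Proof.
case=> SD SM Sc SX p pl; rewrite (monalgE p) big_seq; apply: (big_ind S) => //.
  by rewrite -(rmorph0 (scalars R)).
move=> k /pl; rewrite malgUZ -mulr_algl => kl; apply: (SM); first exact: Sc.
elim/cmonom_ind: k kl => [_|x k IHk xkl]; first by have := Sc 1; rewrite rmorph1.
have -> : << mmul (ucm x) k >> = Xv F x * << k >> by rewrite malgU1M.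
apply: SM; [apply/SX/xkl | apply: IHk => y yk; apply: xkl].
  by rewrite mdomD in_fsetU mdomU in_fset1 eqxx.
by rewrite mdomD in_fsetU yk orbT.
Qed.

Lemma DP_le_generated l :
  exists ys : seq (DP_le l), forall a, generated (scalars (DP_le l)) ys a.
Proof.
pose vars := [seq Xv F (u.1, [ffun j => val (u.2 j)] : {ffun _}) |
  u : ('I_m * {ffun 'I_n -> 'I_l.+1})%type].
exists (pmap insub vars) => a; set G := generated _ _.
have [GD GM Gc] := generated_subalgebra (scalars (DP_le l)) (pmap insub vars).
pose S p := exists2 b : DP_le l, val b = p & G b.
suff [b /val_inj <-] : S (val a) by [].
apply: ord_le_ind (@DP_leP l a) => [|x xl].
  split=> [_ _ [b <- Gb] [c <- Gc']|_ _ [b <- Gb] [c <- Gc']|c].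
  - by exists (b + c); [exact: rmorphD | exact: GD].
  - by exists (b * c); [exact: rmorphM | exact: GM].
  - by exists (in_alg _ c); [exact: val_scalars | exact: Gc].
have [b bE] := ord_le_DP_le (ord_le_Xv xl); exists b => //.
apply: mem_generated; rewrite mem_pmap_sub bE; apply/imageP.
exists (x.1, [ffun j => inord (x.2 j)]); first by [].
case: x xl {bE} => u mu xl; congr (Xv F (_, _)); apply/ffunP=> j.
rewrite !ffunE /= inordK // ltnS; apply: leq_trans xl.
by rewrite /ordv (bigD1 j) //= leq_addr.
Qed.

Lemma krull_chain_ord_le l (I : R -> Prop) d :
  krull_chain (ord_le l) (fun p => I p /\ ord_le l p) d <->
  prime_chain (fun a : DP_le l => I (val a)) d.
Proof.
split=> -[c [c_prime c_strict]].
  exists (fun k a => c k (val a)); split=> k lt_kd.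
    have [[[cS c0 cD cM] c1 cP] Ic] := c_prime k lt_kd.
    split; last by move=> a Ia; apply: Ic; split=> //; apply: DP_leP.
    split; [split|..].
    - by rewrite rmorph0.
    - by move=> a b ca cb; rewrite rmorphD; apply: cD.
    - by move=> r a ca; rewrite rmorphM; apply: cM => //; apply: DP_leP.
    - by rewrite rmorph1.
    - by move=> a b; rewrite rmorphM; apply: cP; apply: DP_leP.
  have [sub [p [cp ncp]]] := c_strict k lt_kd; split=> [a /sub //|].
  have [[[/(_ _ cp) pl _ _ _] _ _] _] := c_prime k.+1 lt_kd.
  by have [a ap] := ord_le_DP_le pl; exists a; rewrite ap.
exists (fun k p => exists2 a, val a = p & c k a); split=> k lt_kd.
  have [[[c0 cD cM] c1 cP] Ic] := c_prime k lt_kd.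
  split; [split; [split|..]|].
  - by move=> _ [a <- _]; apply: DP_leP.
  - by exists 0; rewrite ?rmorph0.
  - by move=> _ _ [a <- ca] [b <- cb]; exists (a + b); [exact: rmorphD | exact: cD].
  - move=> _ _ /ord_le_DP_le[r <-] [a <- ca].
    by exists (r * a); [exact: rmorphM | exact: cM].
  - case=> a a1 ca; apply: c1.
    by rewrite -(val_inj (etrans a1 (esym (rmorph1 _)))).
  - move=> _ _ /ord_le_DP_le[a <-] /ord_le_DP_le[b <-] [ab abE cab].
    move: cab; rewrite (val_inj (etrans abE (esym (rmorphM _ _ _)))).
    by case/cP=> [ca|cb]; [left; exists a | right; exists b].
  - by move=> p [Ip /ord_le_DP_le[a ap]]; exists a => //; apply: Ic; rewrite ap.
have [sub [a [ca nca]]] := c_strict k lt_kd; split.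
  by move=> _ [b <- /sub cb]; exists b.
by exists (val a); split=> [|[b /val_inj ->]]; first exists a.
Qed.

End BoundedOrder.

Arguments DP_leP {F n m l} a.

Section LeibnizRule.

Variables (A : comNzRingType) (D : A -> A).
Hypothesis DD : forall p q, D (p + q) = D p + D q.

Definition leibniz (p q : A) : Prop := D (p * q) = D p * q + p * D q.

Lemma leibniz_additive0 : D 0 = 0.
Proof. by apply: (addrI (D 0)); rewrite -DD !addr0. Qed.

Lemma leibniz11_eq0 : leibniz 1 1 -> D 1 = 0.
Proof.
by rewrite /leibniz !mulr1 mul1r => D1; apply: (addrI (D 1)); rewrite addr0.
Qed.

Lemma leibnizC p q : leibniz q p -> leibniz p q.
Proof. by rewrite /leibniz mulrC => ->; ring. Qed.

Lemma leibniz0 q : leibniz 0 q.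
Proof. by rewrite /leibniz leibniz_additive0 !mul0r leibniz_additive0 addr0. Qed.

Lemma leibnizD p p' q : leibniz p q -> leibniz p' q -> leibniz (p + p') q.
Proof. by rewrite /leibniz mulrDl !DD => -> ->; ring. Qed.

End LeibnizRule.

(* The hypotheses are equations because unification up to conversion between
   distinct monomials of [malg] is prohibitively slow. *)
Lemma leibnizZ (F : nzRingType) (A : comAlgType F) (D : A -> A)
    (a a' da da' : F) (x x' dx dx' p q : A) :
  p = a *: x -> q = a' *: x' ->
  D p = da *: x + a *: dx -> D q = da' *: x' + a' *: dx' ->
  D (p * q) = (da * a' + a * da') *: (x * x') + (a * a') *: (dx * x' + x * dx') ->
  leibniz D p q.
Proof.
rewrite /leibniz => pE qE -> -> ->; rewrite pE qE.
rewrite !mulrDl !mulrDr -!scalerAl -!scalerAr !scalerA scalerDl scalerDr.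
exact: addrACA.
Qed.

Section Derivation.

Variables (F : fieldType) (n : nat) (der : 'I_n -> F -> F) (m : nat).
Hypothesis derP : is_diff_field der.
Local Notation R := (DP F n m).
Local Notation mon := {cmonom (dvar n m)}.
Implicit Types p q : R.

Lemma der0 i : der i 0 = 0.
Proof. by case: derP => _ derD _ _; apply: leibniz_additive0; apply: derD. Qed.

Lemma der1 i : der i 1 = 0.
Proof. by case: derP => _ _ derM _; apply: leibniz11_eq0; apply: derM. Qed.

Lemma dmonEw i (k : mon) (d : {fset dvar n m}) : (finsupp k `<=` d)%fset ->
  dmon F i k = \sum_(x <- d) (k x)%:R * << divcm k (ucm x) >> * Xv F (shiftv i x).
Proof.
move=> kd; apply: big_fset_incl => // x _; rewrite -cmE_eq0 => /eqP ->.
by rewrite mulr0n !mul0r.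
Qed.

Lemma dmonM i (k k' : mon) :
  dmon F i (mmul k k') = dmon F i k * << k' >> + << k >> * dmon F i k'.
Proof.
have divM (u v : mon) x : (u x)%:R * << divcm (mmul u v) (ucm x) >> =
    (u x)%:R * << divcm u (ucm x) >> * << v >> :> R.
  have [->|un0] := eqVneq (u x) 0%N.
    by rewrite mulr0n [LHS]mul0r [0 * _]mul0r mul0r.
  rewrite -mulrA malgU1M; congr (_ * << _ >>); apply/eqP/cmP => y.
  rewrite cmM !divcmE cmM cmU; have [<-|] := eqVneq x y; last by rewrite !subn0.
  by rewrite addnBAC // lt0n.
pose d := (finsupp k `|` finsupp k')%fset.
rewrite (@dmonEw i _ d) ?mdomD // (@dmonEw i k d) ?fsubsetUl //.
rewrite (@dmonEw i k' d) ?fsubsetUr // mulr_suml mulr_sumr -big_split /=.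
have divM' x : (k' x)%:R * << divcm (mmul k k') (ucm x) >> =
    (k' x)%:R * << divcm k' (ucm x) >> * << k >> :> R.
  have -> : mmul k k' = mmul k' k by apply: mulcmC.
  exact: divM.
have natr_leibniz (A : comNzRingType) (a b : nat) (w u v u' v' y : A) :
    a%:R * w = a%:R * u * v' -> b%:R * w = b%:R * v * u' ->
    (a + b)%:R * w * y = a%:R * u * y * v' + u' * (b%:R * v * y).
  by move=> aw bw; rewrite natrD !mulrDl aw bw; ring.
apply: eq_bigr => x _; rewrite cmM.
by apply: natr_leibniz; [exact: divM | exact: divM'].
Qed.

Lemma dderEw i p (d : {fset mon}) : (msupp p `<=` d)%fset ->
  dder der i p = \sum_(k <- d) (<< der i p@_k *g k >> + p@_k *: dmon F i k).
Proof.
move=> pd; apply: big_fset_incl => // k _ /mcoeff_outdom ->.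
by rewrite der0 monalgU0 scale0r addr0.
Qed.

Lemma dderU i c (k : mon) :
  dder der i << c *g k >> = der i c *: << k >> + c *: dmon F i k.
Proof. by rewrite (dderEw _ msuppU_le) big_seq_fset1 mcoeffUU malgUZ. Qed.

Lemma dderD i p q : dder der i (p + q) = dder der i p + dder der i q.
Proof.
case: derP => _ derD _ _.
rewrite (dderEw _ (msuppD_le p q)) (dderEw _ (fsubsetUl (msupp p) (msupp q))).
rewrite (dderEw _ (fsubsetUr (msupp p) (msupp q))) -big_split /=.
apply: eq_bigr => k _; rewrite mcoeffD derD monalgUD scalerDl; exact: addrACA.
Qed.

Lemma dderUM i c (k : mon) c' (k' : mon) :
  leibniz (dder der i) << c *g k >> << c' *g k' >>.
Proof.
case: derP => _ _ derM _.
apply: leibnizZ (malgUZ c k) (malgUZ c' k') (dderU i c k) (dderU i c' k') _.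
apply: etrans (congr1 (dder der i) (malgUM c c' k k')) _.
by rewrite dderU derM dmonM malgU1M.
Qed.

Lemma dderM i p q : leibniz (dder der i) p q.
Proof.
elim/malg_ind: p => [|p p'|c k]; [exact/leibniz0/dderD | exact/leibnizD/dderD |].
apply: leibnizC; elim/malg_ind: q => [|q q'|c' k'].
- exact/leibniz0/dderD.
- exact/leibnizD/dderD.
- exact: dderUM.
Qed.

Lemma dder1 i : dder der i 1 = 0 :> R.
Proof. exact/leibniz11_eq0/dderM. Qed.

Lemma dderB i p q : dder der i (p - q) = dder der i p - dder der i q.
Proof. by apply/(canRL (addrK _)); rewrite -dderD subrK. Qed.

Lemma dder_Xv i (x : dvar n m) : dder der i (Xv F x) = Xv F (shiftv i x).
Proof.
rewrite /Xv dderU der1 scale0r add0r scale1r /dmon mdomU big_seq_fset1.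
rewrite cmUU [1 * _]mul1r malgU1M; congr << _ >>; apply/eqP/cmP => y.
by rewrite cmM divcmE subnn.
Qed.

Lemma ordv_shiftv i (x : dvar n m) : ordv (shiftv i x) = (ordv x).+1.
Proof.
rewrite /ordv /=; under eq_bigr do rewrite ffunE.
rewrite big_split /= [X in (_ + X)%N](bigD1 i) //= eqxx.
by rewrite [X in (1 + X)%N]big1 ?addn0 ?addn1 // => j /negPf ->.
Qed.

Lemma ord_le_dder l i p : ord_le l p -> ord_le l.+1 (dder der i p).
Proof.
move=> pl; apply/ord_leP; rewrite /dder big_seq rpred_sum // => k /pl kl.
rewrite rpredD ?rpredZ //; first by apply/ord_leP/ord_leU => x /kl /leqW.
rewrite /dmon big_seq rpred_sum // => x xk.
rewrite rpredM ?rpredM ?rpred_nat //; apply/ord_leP.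
  apply: ord_leU => y; rewrite -cmE_neq0 divcmE => y0; apply/leqW/kl.
  by rewrite -cmE_neq0; apply: contraNneq y0 => ->.
by apply: ord_le_Xv; rewrite ordv_shiftv ltnS; apply: kl.
Qed.

Lemma dvar_shiftv_ind (P : nat -> dvar n m -> Prop) :
  (forall u, P 0%N (u, [ffun=> 0%N])) ->
  (forall t i x, P t x -> P t.+1 (shiftv i x)) -> forall x, P (ordv x) x.
Proof.
move=> P0 PS x; move tE : (ordv x) => t; elim: t x tE => [|t IH] [u mu] tE.
  rewrite (_ : mu = [ffun=> 0%N]) //; apply/ffunP=> j; rewrite ffunE.
  by move/eqP: tE; rewrite sum_nat_eq0 => /forallP/(_ j)/eqP.
have [i mui] : exists i, (0 < mu i)%N.
  apply/existsP; apply: contraPT tE; rewrite negb_exists => /forallP mu0.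
  by rewrite /ordv big1 // => j _; apply/eqP; rewrite -leqn0 leqNgt.
have xE : (u, mu) = shiftv i (u, [ffun j => (mu j - (j == i))%N]).
  congr (_, _); apply/ffunP=> j; rewrite !ffunE.
  by case: eqVneq => [->|_]; rewrite ?subnK // subn0 addn0.
by rewrite xE; apply/PS/IH; move: tE; rewrite {1}xE ordv_shiftv => -[].
Qed.

End Derivation.

Section DifferentialIdeals.

Variables (F : fieldType) (n : nat) (der : 'I_n -> F -> F) (m : nat).
Hypothesis derP : is_diff_field der.
Local Notation R := (DP F n m).
Implicit Types J H : R -> Prop.

Lemma dideal_gen_dideal (A : R -> Prop) : is_dideal der (dideal_gen der A).
Proof.
split; first split.
- by move=> J [[J0 _ _] _].
- move=> p q Ip Iq J dJ AJ; case: (dJ) => -[_ JD _] _.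
  by apply: JD; [apply: Ip | apply: Iq].
- by move=> r p Ip J dJ AJ; case: (dJ) => -[_ _ JM] _; apply: JM; apply: Ip.
- by move=> i p Ip J dJ AJ; case: (dJ) => _ Jd; apply: Jd; apply: Ip.
Qed.

Lemma mclosM H a b : mclos H a -> mclos H b -> mclos H (a * b).
Proof.
move=> [la [Hla ->]] [lb [Hlb ->]]; exists (la ++ lb); rewrite big_cat; split=> //.
by move=> x; rewrite mem_cat => /orP[/Hla|/Hlb].
Qed.

Lemma saturation_dideal J H : is_dideal der J -> is_dideal der (saturation J H).
Proof.
move=> [[J0 JD JM] Jd]; split; first split.
- by exists 1; rewrite mulr0; split=> //; exists [::]; rewrite big_nil.
- move=> p q [a [ma Ja]] [b [mb Jb]]; exists (a * b); split; first exact: mclosM.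
  have -> : a * b * (p + q) = b * (a * p) + a * (b * q) by ring.
  by apply: JD; apply: JM.
- move=> r p [a [ma Ja]]; exists a; split; first exact: ma.
  have -> : a * (r * p) = r * (a * p) by ring.
  exact: JM.
- move=> i p [a [ma Ja]]; exists (a * a); split; first exact: mclosM.
  have -> : a * a * dder der i p =
      a * dder der i (a * p) + - dder der i a * (a * p).
    rewrite (dderM derP i a p); move: (dder der i a) (dder der i p) => da dp; ring.
  by apply: JD; apply: JM; [apply: Jd; exact: Ja | exact: Ja].
Qed.

Lemma characterizable_dideal J : characterizable der J -> is_dideal der J.
Proof.
case=> rk [S [_ _ JE]].
have [[J0 JD JM] Jd] : is_dideal der (IS der rk (fun s => s \in S)).
  exact/saturation_dideal/dideal_gen_dideal.
split; [split|].
- exact/JE.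
- by move=> p q /JE Jp /JE Jq; apply/JE/JD.
- by move=> r p /JE Jp; apply/JE/JM.
- by move=> i p /JE Jp; apply/JE/Jd.
Qed.

End DifferentialIdeals.

(** * Fractions modulo a differential ideal *)

Section Fractions.

Variables (F : fieldType) (n : nat) (der : 'I_n -> F -> F) (m : nat).
Variable I : DP F n m -> Prop.
Local Notation R := (DP F n m).
Implicit Types (p q : R) (x y z : dfrac F n m).

Lemma frac_ok_poly p : frac_ok I (p, 1).
Proof. by move=> q; rewrite mul1r. Qed.

Lemma nzd_modM p q : nzd_mod I p -> nzd_mod I q -> nzd_mod I (p * q).
Proof. by move=> nzp nzq r; rewrite -mulrA => /nzp /nzq. Qed.

Lemma frac_ok_add x y : frac_ok I x -> frac_ok I y -> frac_ok I (frac_add x y).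
Proof. exact: nzd_modM. Qed.

Lemma frac_ok_mul x y : frac_ok I x -> frac_ok I y -> frac_ok I (frac_mul x y).
Proof. exact: nzd_modM. Qed.

Lemma frac_ok_der i x : frac_ok I x -> frac_ok I (frac_der der i x).
Proof. by move=> okx; apply: nzd_modM. Qed.

Hypothesis idI : is_ideal I.

Lemma frac_eq_refl x : frac_eq I x x.
Proof. by rewrite /frac_eq subrr; case: idI. Qed.

Lemma frac_eq_sym x y : frac_eq I x y -> frac_eq I y x.
Proof.
rewrite /frac_eq => xy; have [_ _ IM] := idI.
have -> : y.1 * x.2 - x.1 * y.2 = -1 * (x.1 * y.2 - y.1 * x.2) by ring.
exact: IM.
Qed.

Lemma frac_eq_trans y x z :
  frac_ok I y -> frac_eq I x y -> frac_eq I y z -> frac_eq I x z.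
Proof.
move=> oky xy yz; apply: oky.
have -> : y.2 * (x.1 * z.2 - z.1 * x.2) =
  z.2 * (x.1 * y.2 - y.1 * x.2) + x.2 * (y.1 * z.2 - z.1 * y.2) by ring.
exact: (ideal_lincomb _ _ idI xy yz).
Qed.

Lemma frac_eq_add x x' y y' :
  frac_eq I x y -> frac_eq I x' y' -> frac_eq I (frac_add x x') (frac_add y y').
Proof.
rewrite /frac_eq /frac_add /= => xy xy'.
have -> : (x.1 * x'.2 + x'.1 * x.2) * (y.2 * y'.2) -
    (y.1 * y'.2 + y'.1 * y.2) * (x.2 * x'.2) =
  (x'.2 * y'.2) * (x.1 * y.2 - y.1 * x.2) +
  (x.2 * y.2) * (x'.1 * y'.2 - y'.1 * x'.2) by ring.
exact: (ideal_lincomb _ _ idI xy xy').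
Qed.

Lemma frac_eq_mul x x' y y' :
  frac_eq I x y -> frac_eq I x' y' -> frac_eq I (frac_mul x x') (frac_mul y y').
Proof.
rewrite /frac_eq /frac_mul /= => xy xy'.
have -> : x.1 * x'.1 * (y.2 * y'.2) - y.1 * y'.1 * (x.2 * x'.2) =
  (x'.1 * y'.2) * (x.1 * y.2 - y.1 * x.2) +
  (y.1 * x.2) * (x'.1 * y'.2 - y'.1 * x'.2) by ring.
exact: (ideal_lincomb _ _ idI xy xy').
Qed.

Lemma frac_eq_scale c x y :
  frac_eq I x y -> frac_eq I (frac_scale c x) (frac_scale c y).
Proof.
have scaleE (A : comAlgType F) (a b a' b' : A) :
    (c *: a) * b - (c *: a') * b' = c%:A * (a * b - a' * b').
  by rewrite mulr_algl scalerBr !scalerAl.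
move=> xy; rewrite /frac_eq /= (scaleE R x.1 y.2 y.1 x.2).
by have [_ _ IM] := idI; apply: IM.
Qed.

Lemma frac_eq_der i x y : is_diff_field der -> is_dideal der I ->
  frac_eq I x y -> frac_eq I (frac_der der i x) (frac_der der i y).
Proof.
move=> derP [_ dI] xy.
have derE (A : comNzRingType) (D : A -> A) (a b a' b' : A) :
    (forall u v, D (u - v) = D u - D v) -> (forall u v, leibniz D u v) ->
    (D a * b - a * D b) * (b' * b') - (D a' * b' - a' * D b') * (b * b) =
    (b * b') * D (a * b' - a' * b) + (- D b * b' - b * D b') * (a * b' - a' * b).
  by move=> DB DM; rewrite DB !DM; ring.
rewrite /frac_eq /= (derE R (dder der i) _ _ _ _ (dderB derP i) (dderM derP i)).
exact: (ideal_lincomb _ _ idI (dI i _ xy) xy).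
Qed.

End Fractions.

Arguments frac_ok_poly {F n m} I p.

Section BirationalInverse.

Variables (F : fieldType) (n : nat) (der : 'I_n -> F -> F) (m k : nat).
Variables (I : DP F n m -> Prop) (J : DP F n k -> Prop).
Variable phi : dfrac F n m -> dfrac F n k.
Hypotheses (derP : is_diff_field der) (didJ : is_dideal der J).

Lemma exists_birational_section : diff_birational der I J phi ->
  exists psi, forall u, frac_ok J u ->
    [/\ frac_ok I (psi u), frac_eq J (phi (psi u)) u &
        forall x, frac_ok I x -> frac_eq J (phi x) u -> frac_eq I (psi u) x].
Proof.
move=> [phi_ok phi_inj phi_surj _ _].
have /boolp.choice[psi psiP] : forall u, exists x, frac_ok J u ->
    frac_ok I x /\ frac_eq J (phi x) u.
  move=> u; have [/phi_surj[x okx xu]|nok] := boolp.pselect (frac_ok J u).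
    by exists x.
  by exists (frac_one F n m).
exists psi => u oku; have [ok_psi phi_psi] := psiP u oku; split=> // x okx xu.
apply/(phi_inj _ _ ok_psi okx).
exact: (frac_eq_trans didJ.1 oku phi_psi (frac_eq_sym didJ.1 xu)).
Qed.

Lemma diff_birational_inverse :
  diff_birational der I J phi -> exists psi, diff_birational der J I psi.
Proof.
move=> phiP; have [psi psiP] := exists_birational_section phiP.
case: phiP => phi_ok phi_inj _ phi_ring [phi_scale phi1 phi_der].
have idJ := didJ.1.
have psi_ok u : frac_ok J u -> frac_ok I (psi u) by move=> /psiP[].
have psiK u : frac_ok J u -> frac_eq J (phi (psi u)) u by move=> /psiP[].
have psi_eq u x (oku : frac_ok J u) : frac_ok I x -> frac_eq J (phi x) u ->
  frac_eq I (psi u) x by have [_ _] := psiP u oku; apply.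
exists psi; split.
- exact: psi_ok.
- move=> u v oku okv; have [oku' okv'] := (psi_ok u oku, psi_ok v okv).
  split=> [uv|].
    apply: (psi_eq _ _ oku okv').
    exact: (frac_eq_trans idJ okv (psiK v okv) (frac_eq_sym idJ uv)).
  move/(phi_inj _ _ oku' okv') => uv.
  apply: (frac_eq_trans idJ (phi_ok _ oku') (frac_eq_sym idJ (psiK u oku))).
  exact: (frac_eq_trans idJ (phi_ok _ okv') uv (psiK v okv)).
- move=> x okx; exists (phi x); first exact: phi_ok.
  exact: (psi_eq _ _ (phi_ok x okx) okx (frac_eq_refl idJ _)).
- move=> u v oku okv; have [oku' okv'] := (psi_ok u oku, psi_ok v okv).
  have [phiD phiM] := phi_ring _ _ oku' okv'; split.
    apply: (psi_eq _ _ (frac_ok_add oku okv) (frac_ok_add oku' okv')).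
    apply: (frac_eq_trans idJ (frac_ok_add (phi_ok _ oku') (phi_ok _ okv')) phiD).
    exact: frac_eq_add (psiK u oku) (psiK v okv).
  apply: (psi_eq _ _ (frac_ok_mul oku okv) (frac_ok_mul oku' okv')).
  apply: (frac_eq_trans idJ (frac_ok_mul (phi_ok _ oku') (phi_ok _ okv')) phiM).
  exact: frac_eq_mul (psiK u oku) (psiK v okv).
split.
- move=> c u oku; have oku' := psi_ok u oku.
  apply: (psi_eq (frac_scale c u) (frac_scale c (psi u)) oku oku').
  apply: (frac_eq_trans (y := frac_scale c (phi (psi u))) idJ (phi_ok _ oku')).
    exact: phi_scale oku'.
  exact: frac_eq_scale (psiK u oku).
- exact: (psi_eq _ _ (frac_ok_poly J 1) (frac_ok_poly I 1) phi1).
- move=> i u oku; have oku' := psi_ok u oku.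
  apply: (psi_eq _ _ (frac_ok_der oku) (frac_ok_der oku')).
  apply: (frac_eq_trans idJ (frac_ok_der (phi_ok _ oku')) (phi_der i _ oku')).
  exact: frac_eq_der (psiK u oku).
Qed.

End BirationalInverse.

(** * Order shift of a differential birational map *)

Section OrderShift.

Variables (F : fieldType) (n : nat) (der : 'I_n -> F -> F) (m k : nat).
Variables (I : DP F n m -> Prop) (J : DP F n k -> Prop).
Variable phi : dfrac F n m -> dfrac F n k.
Hypotheses (derP : is_diff_field der) (didJ : is_dideal der J).
Hypothesis phiP : diff_birational der I J phi.
Local Notation A := (DP F n m).
Local Notation B := (DP F n k).
Let idJ : is_ideal J := didJ.1.

Definition frac_image (p : A) (b s : B) : Prop :=
  nzd_mod J s /\ frac_eq J (phi (p, 1)) (b, s).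

Lemma frac_image_add p b s p' b' s' :
  frac_image p b s -> frac_image p' b' s' ->
  frac_image (p + p') (b * s' + b' * s) (s * s').
Proof.
case: phiP => phi_ok _ _ phi_ring _ [oks pb] [oks' pb'].
split; first exact: nzd_modM.
have [okp okp'] := (frac_ok_poly I p, frac_ok_poly I p').
have [phiD _] := phi_ring _ _ okp okp'.
have -> : (p + p', 1) = frac_add (p, 1) (p', 1) by rewrite /frac_add /= !mulr1.
apply: (frac_eq_trans idJ (frac_ok_add (phi_ok _ okp) (phi_ok _ okp')) phiD).
exact: frac_eq_add pb pb'.
Qed.

Lemma frac_image_mul p b s p' b' s' :
  frac_image p b s -> frac_image p' b' s' -> frac_image (p * p') (b * b') (s * s').
Proof.
case: phiP => phi_ok _ _ phi_ring _ [oks pb] [oks' pb'].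
split; first exact: nzd_modM.
have [okp okp'] := (frac_ok_poly I p, frac_ok_poly I p').
have [_ phiM] := phi_ring _ _ okp okp'.
have -> : (p * p', 1) = frac_mul (p, 1) (p', 1) by rewrite /frac_mul /= !mulr1.
apply: (frac_eq_trans idJ (frac_ok_mul (phi_ok _ okp) (phi_ok _ okp')) phiM).
exact: frac_eq_mul pb pb'.
Qed.

Lemma frac_image_scalar c : frac_image (scalars A c) (scalars B c) 1.
Proof.
case: phiP => phi_ok _ _ _ [phi_scale phi1 _].
split; first exact: (frac_ok_poly J 0).
have ok1 := frac_ok_poly I 1.
apply: (frac_eq_trans (y := frac_scale c (phi (1, 1))) idJ (phi_ok _ ok1)).
  exact: phi_scale ok1.
exact: frac_eq_scale phi1.
Qed.

Lemma frac_image_denom p b s : frac_image p b s -> frac_image 1 s s.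
Proof.
case: phiP => _ _ _ _ [_ phi1 _] [oks _]; split; first exact: oks.
apply: (frac_eq_trans idJ (frac_ok_poly J 1) phi1).
by rewrite /frac_eq /= mul1r mulr1 subrr; case: idJ.
Qed.

Lemma frac_image_relation : fraction_relation (scalars A) (scalars B) frac_image.
Proof.
split.
- exact: frac_image_add.
- exact: frac_image_mul.
- exact: frac_image_scalar.
- exact: frac_image_denom.
Qed.

Lemma frac_image_der i p b s : frac_image p b s ->
  frac_image (dder der i p) (dder der i b * s - b * dder der i s) (s * s).
Proof.
case: phiP => phi_ok _ _ _ [_ _ phi_der] [oks pb]; split; first exact: nzd_modM.
have okp := frac_ok_poly I p.
have -> : (dder der i p, 1) = frac_der der i (p, 1).
  by rewrite /frac_der /= (dder1 m derP) mulr0 subr0 !mulr1.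
apply: (frac_eq_trans idJ (frac_ok_der (phi_ok _ okp)) (phi_der i _ okp)).
exact: frac_eq_der pb.
Qed.

Lemma frac_image_ideal p b s : frac_image p b s -> J b -> I p.
Proof.
case: phiP => phi_ok phi_inj _ _ _ [oks pb] Jb.
have [_] := frac_image_scalar 0; rewrite !rmorph0 => phi0.
have okp := frac_ok_poly I p; have ok0 := frac_ok_poly I 0.
suff : frac_eq I (p, 1) (0, 1) by rewrite /frac_eq /= mulr1 mul0r subr0.
apply/(phi_inj _ _ okp ok0); apply: (frac_eq_trans (y := (b, s)) idJ oks pb).
apply: (frac_eq_trans idJ (frac_ok_poly J 0) _ (frac_eq_sym idJ phi0)).
by rewrite /frac_eq /= mulr1 mul0r subr0.
Qed.

Definition frac_image_le l p : Prop :=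
  exists b s, [/\ ord_le l b, ord_le l s & frac_image p b s].

Lemma frac_image_leW l l' p :
  (l <= l')%N -> frac_image_le l p -> frac_image_le l' p.
Proof.
move=> le_ll' [b [s [bl sl pb]]]; exists b, s.
by split; [exact: ord_leW bl | exact: ord_leW sl | exact: pb].
Qed.

Lemma frac_image_le_subalgebra l : subalgebra (scalars A) (frac_image_le l).
Proof.
split=> [p p' [b [s [bl sl pb]]] [b' [s' [bl' sl' pb']]]|
         p p' [b [s [bl sl pb]]] [b' [s' [bl' sl' pb']]]|c].
- exists (b * s' + b' * s), (s * s').
  split; [by apply: ord_leD; apply: ord_leM | exact: (ord_leM sl sl') |].
  exact: frac_image_add.
- exists (b * b'), (s * s').
  by split; [apply: ord_leM | apply: ord_leM | apply: frac_image_mul].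
- exists (scalars B c), 1; split; last exact: frac_image_scalar.
    by apply/ord_leP; rewrite rpredZ ?rpred1.
  by apply/ord_leP; rewrite rpred1.
Qed.

Lemma frac_image_le_dder l i p :
  frac_image_le l p -> frac_image_le l.+1 (dder der i p).
Proof.
case=> b [s [bl sl pb]].
have bl' : ord_le l.+1 b := ord_leW (leqnSn l) bl.
have sl' : ord_le l.+1 s := ord_leW (leqnSn l) sl.
have dbl : ord_le l.+1 (dder der i b) by apply: ord_le_dder.
have dsl : ord_le l.+1 (dder der i s) by apply: ord_le_dder.
exists (dder der i b * s - b * dder der i s), (s * s); split.
- exact: ord_leB (ord_leM dbl sl') (ord_leM bl' dsl).
- exact: (ord_leM sl' sl').
- exact: frac_image_der.
Qed.

Lemma exists_frac_image_le p : exists l, frac_image_le l p.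
Proof.
pose y := phi (p, 1).
have [[lb bl] [ls sl]] := (exists_ord_le y.1, exists_ord_le y.2).
exists (maxn lb ls), y.1, y.2.
split; [exact: ord_leW (leq_maxl _ _) bl | exact: ord_leW (leq_maxr _ _) sl |].
case: phiP => phi_ok _ _ _ _; split; first exact: phi_ok (frac_ok_poly I p).
by rewrite -surjective_pairing; apply: frac_eq_refl.
Qed.

Lemma frac_image_order_shift :
  exists l0, forall l p, ord_le l p -> frac_image_le (l + l0) p.
Proof.
have /boolp.choice[lu luP] : forall u : 'I_m, exists l,
    frac_image_le l (Xv F (u, [ffun=> 0%N])).
  by move=> u; apply: exists_frac_image_le.
exists (\max_u lu u) => l p; apply: ord_le_ind => [|x xl].
  exact: frac_image_le_subalgebra.
apply: (@frac_image_leW (ordv x + \max_u lu u)); first by rewrite leq_add2r.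
apply: (@dvar_shiftv_ind n m (fun t x => frac_image_le (t + \max_u lu u) (Xv F x))).
  by move=> u; apply: frac_image_leW (luP u); rewrite add0n; apply: leq_bigmax.
by move=> t i x' /(frac_image_le_dder i); rewrite (dder_Xv derP).
Qed.

Lemma krull_chain_order_shift : exists l0, forall l d,
  krull_chain (ord_le l) (fun p => I p /\ ord_le l p) d ->
  krull_chain (ord_le (l + l0)) (fun p => J p /\ ord_le (l + l0) p) d.
Proof.
have [l0 shift] := frac_image_order_shift; exists l0 => l d.
set l' := (l + l0)%N; pose f := scalars (DP_le F n m l).
move=> /krull_chain_ord_le /(prime_chain_independent f)[x indep].
apply/krull_chain_ord_le.
have /boolp.choice[b /boolp.choice[s bsP]] : forall j, exists b s : DP_le F n k l',
    frac_image (val (x j)) (val b) (val s).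
  move=> j; have [_ [_ [/ord_le_DP_le[b <-] /ord_le_DP_le[s <-] xj]]] :=
    shift l _ (DP_leP (x j)).
  by exists b, s.
have [||K [h [hJ hs indepK]]] :=
    exists_independent_residue (J := J) (d := d) (x := val \o x)
      (b := val \o b) (s := val \o s) frac_image_relation idJ.
- by move=> j _; apply: bsP.
- move=> e r t er Jr; apply: indep; rewrite -iter_eval_comp.
  rewrite (eq_iter_eval (f' := scalars A) (x' := val \o x)) //.
  exact: frac_image_ideal er Jr.
have [ys gen] := DP_le_generated F n k l'.
apply: (@prime_chain_subset _ _ (fun a => (h \o val) a = 0)) => [a /hJ //|].
have [char0 _ _ _] := derP.
apply: (independent_prime_chain char0 gen (b := b) (s := s)) => //.
exact: eq_algebraically_independent indepK.
Qed.

End OrderShift.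

(** * Comparison of numerical polynomials *)

Section EventualComparison.

Variable R : archiRealFieldType.
Implicit Types p q : {poly R}.

Lemma lead_coef_gt0_eventually_ge p : 0 < lead_coef p ->
  exists a N, 0 < a /\ forall l : nat, (N <= l)%N -> a <= p.[l%:R].
Proof.
elim/poly_ind: p => [|p c IH]; first by rewrite lead_coef0 ltxx.
have [->|pn0] := eqVneq p 0.
  by rewrite mul0r add0r lead_coefC; exists c, 0%N; split=> // l _; rewrite hornerC.
rewrite lead_coefDl ?lead_coefMX; last first.
  by rewrite size_mulX // (leq_ltn_trans (size_polyC_leq1 c)) // ltnS size_poly_gt0.
case/IH=> a [N [a_gt0 p_ge]]; exists a, (maxn N (Num.bound (1 + `|c| / a))).
split=> // l; rewrite geq_max => /andP[/p_ge pl lb]; rewrite !hornerE.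
have l_ge : 1 + `|c| / a <= l%:R.
  have bound_ge0 : 0 <= 1 + `|c| / a by rewrite addr_ge0 // divr_ge0 // ltW.
  by rewrite (le_trans (ltW (archi_boundP bound_ge0))) // ler_nat.
have al_ge : a + `|c| <= a * l%:R.
  have -> : a + `|c| = a * (1 + `|c| / a) by field; rewrite gt_eqF.
  by rewrite ler_pM2l.
have pl_ge : a * l%:R <= p.[l%:R] * l%:R by rewrite ler_wpM2r.
have := ler_norm (- c); rewrite normrN => c_ge; lra.
Qed.

Lemma eventually_ge0_lead_coef p N :
  (forall l : nat, (N <= l)%N -> 0 <= p.[l%:R]) -> 0 <= lead_coef p.
Proof.
move=> p_ge0; rewrite leNgt -oppr_gt0 -lead_coefN; apply/negP.
case/lead_coef_gt0_eventually_ge=> a [M [a_gt0 pN_ge]].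
have := pN_ge _ (leq_maxr N M); have := p_ge0 _ (leq_maxl N M).
by rewrite hornerN; lra.
Qed.

Lemma coef_top_ge0 p i : (size p <= i.+1)%N -> 0 <= lead_coef p -> 0 <= p`_i.
Proof.
rewrite leq_eqVlt => /predU1P[szp|szp _]; last by rewrite nth_default.
by rewrite lead_coefE szp.
Qed.

Lemma dominated_lead_coef p q N s :
  (forall l : nat, (N <= l)%N -> 0 <= p.[l%:R] <= q.[(l + s)%:R]) ->
  (size p <= size q)%N /\ (size p = size q -> lead_coef p <= lead_coef q).
Proof.
move=> dom; pose q' := q \Po ('X + s%:R%:P).
have szX : size ('X + s%:R%:P : {poly R}) = 2 by rewrite size_XaddC.
have szq : size q' = size q by rewrite size_comp_poly2.
have lq : lead_coef q' = lead_coef q.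
  by rewrite lead_coef_comp ?szX // lead_coefXaddC expr1n mulr1.
have lp_ge0 : 0 <= lead_coef p.
  by apply: (eventually_ge0_lead_coef (N := N)) => l /dom /andP[].
have lqp_ge0 : 0 <= lead_coef (q' - p).
  apply: (eventually_ge0_lead_coef (N := N)) => l /dom /andP[_ le_pq].
  by rewrite hornerD hornerN horner_comp hornerD hornerX hornerC -natrD subr_ge0.
have lp_le : (size q <= size p)%N -> lead_coef p <= q'`_(size p).-1.
  move=> le_qp; rewrite -subr_ge0 [lead_coef p]lead_coefE -coefB.
  apply: coef_top_ge0 lqp_ge0; apply: leq_trans (size_polyD _ _) _.
  by rewrite size_polyN szq geq_max (leq_trans le_qp) leqSpred.
split=> [|sz_pq]; last first.
  by have := lp_le; rewrite sz_pq leqnn -szq -lead_coefE lq; apply.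
rewrite leqNgt; apply/negP=> lt_qp.
have q'0 : q'`_(size p).-1 = 0.
  by rewrite nth_default // szq -ltnS prednK // (leq_ltn_trans _ lt_qp).
have := lp_le (ltnW lt_qp); rewrite q'0 => lp_le0.
have /eqP : lead_coef p = 0 by apply/le_anti/andP.
by rewrite lead_coef_eq0 => /eqP p0; move: lt_qp; rewrite p0 size_poly0.
Qed.

End EventualComparison.

Lemma size_sub_same_lead (R : nzRingType) (p q : {poly R}) :
  size p = size q -> lead_coef p = lead_coef q -> (size (p - q)%R <= (size p).-1)%N.
Proof.
move=> sz lc; apply/leq_sizeP => j; rewrite leq_eqVlt coefB => /predU1P[<-|lt_j].
  by rewrite {2}sz -!lead_coefE lc subrr.
by rewrite !nth_default ?subrr // -?sz; case: (size p) lt_j.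
Qed.

Lemma size_binpoly i : size (binpoly i) = i.+1.
Proof.
have szf (j : 'I_i) :
    size (('X + j.+1%:R%:P) * (j.+1%:R^-1)%:P : {poly rat}) = 2.
  by rewrite mulrC mul_polyC size_scale ?size_XaddC // invr_eq0 pnatr_eq0.
rewrite size_prod => [|j _]; last by rewrite -size_poly_eq0 szf.
rewrite (eq_bigr _ (fun j _ => szf j)) sum_nat_const card_ord.
by rewrite muln2 -addnn -addSn addnK.
Qed.

Lemma binpoly_coef_eq0 n (c : 'I_n -> rat) (i : 'I_n) :
  (size (\sum_(j < n) c j *: binpoly j)%R <= i)%N -> c i = 0.
Proof.
move=> szi; apply/eqP/negPn/negP => ci_neq0.
have [j cj_neq0 j_max] := @arg_maxnP _ i (fun j => c j != 0) val ci_neq0.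
have : (\sum_(j < n) c j *: binpoly j)`_j = 0.
  by rewrite nth_default //; apply: leq_trans szi _; apply: j_max.
rewrite coef_sum (bigD1 j) //= big1 ?addr0 => [/eqP|k ne_kj].
  rewrite coefZ -[X in _`_X]/(j.+1.-1) -(size_binpoly j) -lead_coefE.
  by rewrite mulf_eq0 (negPf cj_neq0) lead_coef_eq0 -size_poly_eq0 size_binpoly.
rewrite coefZ; have [lt_kj|le_jk] := ltnP k j.
  by rewrite nth_default ?mulr0 // size_binpoly.
suff -> : c k = 0 by rewrite mul0r.
apply/eqP/negPn/negP => /j_max le_kj; case/eqP: ne_kj.
by apply/val_inj/eqP; rewrite eqn_leq le_jk andbT.
Qed.

Lemma krull_chain_leq (F : fieldType) n m (S J : DP F n m -> Prop) d d' :
  (d' <= d)%N -> krull_chain S J d -> krull_chain S J d'.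
Proof.
move=> le_d'd [c [c_prime c_strict]]; exists c; split=> k lt_kd.
  exact: c_prime (leq_trans lt_kd le_d'd).
exact: c_strict (leq_trans lt_kd le_d'd).
Qed.

Lemma dim_poly_dominated (F : fieldType) n m k (I : DP F n m -> Prop)
    (J : DP F n k -> Prop) (omegaI omegaJ : {poly rat}) l0 :
  (forall l d, krull_chain (ord_le l) (fun p => I p /\ ord_le l p) d ->
    krull_chain (ord_le (l + l0)) (fun p => J p /\ ord_le (l + l0) p) d) ->
  is_dim_poly I omegaI -> is_dim_poly J omegaJ ->
  exists N, forall l : nat, (N <= l)%N ->
    0 <= omegaI.[l%:R] <= omegaJ.[(l + l0)%:R].
Proof.
move=> shift [N dimI] [M dimJ]; exists (maxn N M) => l.
rewrite geq_max => /andP[le_Nl le_Ml].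
have [d [[chain_d _] ->]] := dimI l le_Nl.
have [e [[_ no_chain] ->]] := dimJ (l + l0)%N (leq_trans le_Ml (leq_addr _ _)).
rewrite ler0n ler_nat leqNgt; apply/negP=> lt_ed; apply: no_chain.
exact: krull_chain_leq lt_ed (shift _ _ chain_d).
Qed.

Theorem theorem1 (F : fieldType) (n : nat) (der : 'I_n -> F -> F)
  (m k : nat) (I : DP F n m -> Prop) (J : DP F n k -> Prop)
  (phi : dfrac F n m -> dfrac F n k)
  (omegaI omegaJ : {poly rat}) (a b : 'I_n.+1 -> int) :
  is_diff_field der ->
  characterizable der I -> characterizable der J ->
  diff_birational der I J phi ->
  is_dim_poly I omegaI -> is_dim_poly J omegaJ ->
  omegaI = \sum_(i < n.+1) (a i)%:~R *: binpoly i ->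
  omegaJ = \sum_(i < n.+1) (b i)%:~R *: binpoly i ->
  size omegaI = size omegaJ /\
  forall i : 'I_n.+1, ((size omegaI).-1 <= i)%N -> a i = b i.
Proof.
move=> derP /(characterizable_dideal derP) dI /(characterizable_dideal derP) dJ.
move=> phiP dimI dimJ omegaIE omegaJE.
have [psi psiP] := diff_birational_inverse derP dJ phiP.
have [l0 shiftIJ] := krull_chain_order_shift derP dJ phiP.
have [l1 shiftJI] := krull_chain_order_shift derP dI psiP.
have [_ /dominated_lead_coef[le_sz le_lc]] := dim_poly_dominated shiftIJ dimI dimJ.
have [_ /dominated_lead_coef[ge_sz ge_lc]] := dim_poly_dominated shiftJI dimJ dimI.
have sz : size omegaI = size omegaJ by apply/eqP; rewrite eqn_leq le_sz ge_sz.
have lc : lead_coef omegaI = lead_coef omegaJ.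
  by apply/le_anti; rewrite le_lc ?ge_lc.
split=> // i le_di; apply/eqP; rewrite -subr_eq0 -(intr_eq0 rat) rmorphB; apply/eqP.
apply: (@binpoly_coef_eq0 _ (fun j => (a j)%:~R - (b j)%:~R)).
under eq_bigr do rewrite scalerBl; rewrite sumrB -omegaIE -omegaJE.
exact: leq_trans (size_sub_same_lead sz lc) le_di.
Qed.
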